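(* Let $\zeta\in[0,\infty)$ and $\alpha\in(0,2)$. There is a constant $C>0$ depending only on $\zeta$ and $\alpha$ such that for all $r,s,z,t,\tau>0$, \[ \min\Big\{\Big(\frac{r+z}{r+s+z}\Big)^{2\zeta}p_\zeta^{(\alpha)}(t,r,z),\ \Big(\frac{s+z}{r+s+z}\Big)^{2\zeta}p_\zeta^{(\alpha)}(\tau,z,s)\Big\}\le C\,p_\zeta^{(\alpha)}(t+\tau,r,s), \] and \[ p_\zeta^{(\alpha)}(t,r,z)\,p_\zeta^{(\alpha)}(\tau,z,s)\le C\,p_\zeta^{(\alpha)}(t+\tau,r,s)\Big[\Big(\frac{r+s+z}{s+z}\Big)^{2\zeta}p_\zeta^{(\alpha)}(t,r,z)+\Big(\frac{r+s+z}{r+z}\Big)^{2\zeta}p_\zeta^{(\alpha)}(\tau,z,s)\Big]. \]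
   Context: For $\nu\in\mathbb{C}$, $I_\nu$ is the modified Bessel function of the first kind. For $\zeta\in(-1/2,\infty)$, $p_\zeta^{(2)}(t,r,s):=\frac{(rs)^{1/2-\zeta}}{2t}\exp\big(-\frac{r^2+s^2}{4t}\big)I_{\zeta-1/2}\big(\frac{rs}{2t}\big)$ for $r,s,t>0$. For $\alpha\in(0,2)$ and $t>0$, $\sigma_t^{(\alpha/2)}$ is the probability density on $(0,\infty)$ with $e^{-t\lambda^{\alpha/2}}=\int_0^\infty e^{-\tau\lambda}\sigma_t^{(\alpha/2)}(\tau)\,d\tau$ for $\lambda\ge0$, and $p_\zeta^{(\alpha)}(t,r,s):=\int_0^\infty p_\zeta^{(2)}(\tau,r,s)\sigma_t^{(\alpha/2)}(\tau)\,d\tau$. *)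

(* Defs.v *)
From HB Require Import structures.
From mathcomp Require Import all_boot all_order all_algebra.
From mathcomp Require Import all_classical all_reals all_analysis.
Set Implicit Arguments. Unset Strict Implicit. Unset Printing Implicit Defensive.
Import Order.TTheory GRing.Theory Num.Theory.
Import numFieldNormedType.Exports.
Local Open Scope classical_set_scope.
Local Open Scope ring_scope.

Section Defs.
Variable R : realType.
Local Notation mu := (@lebesgue_measure R).

Definition Gamma (a : R) : R :=
  fine (\int[mu]_(x in `]0%R, +oo[) (x `^ (a - 1) * expR (- x))%:E)%E.

Definition besselI (nu x : R) : R :=
  limn (series (fun k : nat =>
    (x / 2) `^ (2 * k%:R + nu) / ((k`!)%:R * Gamma (k%:R + nu + 1)))).

Definition p2 (zeta t r s : R) : R :=
  (r * s) `^ (2^-1 - zeta) / (2 * t) * expR (- (r ^+ 2 + s ^+ 2) / (4 * t))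
  * besselI (zeta - 2^-1) (r * s / (2 * t)).

(* sigma t is, for every t > 0, the density on (0,oo) of the (alpha/2)-stable
   subordinator at time t: a nonnegative measurable probability density whose
   Laplace transform is lambda |-> exp(-t lambda^(alpha/2)). *)
Definition is_stable_subordinator_density (alpha : R) (sigma : R -> R -> R) :=
  forall t : R, 0 < t ->
    [/\ (forall u, 0 < u -> 0 <= sigma t u),
        measurable_fun (`]0%R, +oo[ : set R) (sigma t),
        (\int[mu]_(u in `]0%R, +oo[) (sigma t u)%:E = 1)%E &
        forall lam : R, 0 <= lam ->
          (\int[mu]_(u in `]0%R, +oo[) (expR (- (u * lam)) * sigma t u)%:E)%E
          = (expR (- (t * lam `^ (alpha / 2))))%:E].

(* p^(alpha)_zeta(t,r,s) = int_0^oo p^(2)_zeta(u,r,s) sigma_t(u) du, as an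
   extended real (the integrand is nonnegative). *)
Definition palpha (sigma : R -> R -> R) (zeta t r s : R) : \bar R :=
  (\int[mu]_(u in `]0%R, +oo[) (p2 zeta u r s * sigma t u)%:E)%E.

End Defs.

(* Main.v *)
Require Import Defs.
From HB Require Import structures.
From mathcomp Require Import all_boot all_order all_algebra.
From mathcomp Require Import all_classical all_reals all_analysis.
From mathcomp Require Import measurable_realfun zify ring lra.
Set Implicit Arguments. Unset Strict Implicit. Unset Printing Implicit Defensive.
Import Order.TTheory GRing.Theory Num.Theory.
Import numFieldNormedType.Exports.
Local Open Scope classical_set_scope.
Local Open Scope ring_scope.

(** With T = t^(1/alpha), the kernel p^(alpha)_zeta(t,r,s) is comparable to
    t / ((T + |r-s|)^(1+alpha) (T+r+s)^(2 zeta)), and for this profile the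
    minimum inequality is elementary: for one of the pairs (t,r,z), (tau,z,s),
    both factors of the denominator dominate, up to the weight, those of
    (t+tau,r,s).  The product inequality follows from the minimum inequality.

    The comparison rests on two facts.  First, k! Gamma(k+zeta+1/2) is
    comparable to (2k)! 4^(-k) (k+1)^zeta, so the Bessel series is squeezed
    between exponential series, which yields
    I_(zeta-1/2)(x) ~ x^(zeta-1/2) (1+x)^(-zeta) e^x and a two-sided Gaussian
    bound for p^(2)_zeta.  Second, no pointwise information on sigma_t is used,
    only its Laplace transform: negative moments come from dominating u^(-a) by
    a series of exponentials e^(-k u), tails from
    E(1 - e^(-lam U)) <= t lam^(alpha/2), and the mass of an annulus [ay, by] is
    bounded below through
    1 - e^(-u/y) <= 1_[ay,by](u) + 2a (1 - e^(-u/(ay))) + 2 (1 - e^(-u/(by))). *)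

(** * Monotonicity of integrals and elementary inequalities for real powers *)

Section Tools.
Variable R : realType.
Local Notation mu := (@lebesgue_measure R).

(** The integral of a nonnegative function is a supremum over the simple functions below it, and a
    larger function has more of them. This allows [p2], a limit of series in disguise, to be
    compared with simple bounds without a proof that it is measurable in the time variable. *)
Lemma ge0_le_integral_nonmeas d (T : measurableType d) (m : {measure set T -> \bar R})
    (D : set T) (f g : T -> \bar R) :
  (forall x, D x -> 0 <= f x)%E -> (forall x, D x -> f x <= g x)%E ->
  (\int[m]_(x in D) f x <= \int[m]_(x in D) g x)%E.
Proof.
move=> f0 fg.
have g0 x : D x -> (0 <= g x)%E by move=> Dx; apply: le_trans (f0 x Dx) (fg x Dx).
rewrite !ge0_integralE//; apply: le_ereal_sup => _ [h /= hf <-].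
exists h => // x.
apply: le_trans (hf x) _; rewrite /patch; case: ifPn => // /set_mem; exact: fg.
Qed.

Lemma ln_le_subr1 (v : R) : 0 < v -> ln v <= v - 1.
Proof.
by move=> v0; have := @le_ln1Dx R (v - 1); rewrite addrCA subrr addr0; apply; lra.
Qed.

(** In logarithmic form: [p * ln (x / (p + 1)) <= p * x / (p + 1) <= x]. The shift by one keeps the
    base positive when [p = 0]. *)
Lemma powR_le_expR (p x : R) : 0 <= p -> 0 < x -> x `^ p <= (p + 1) `^ p * expR x.
Proof.
move=> p0 x0; have q0 : 0 < p + 1 by lra.
rewrite /powR !gt_eqF// -expRD ler_expR.
have -> : ln x = ln (p + 1) + ln (x / (p + 1)).
  by rewrite -lnM ?posrE ?divr_gt0// mulrC divfK ?gt_eqF.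
rewrite mulrDr lerD2l.
have le1 : ln (x / (p + 1)) <= x / (p + 1).
  by apply: le_trans (ln_le_subr1 (divr_gt0 x0 q0)) _; lra.
apply: le_trans (ler_wpM2l p0 le1) _.
rewrite mulrA ler_pdivrMr//; nra.
Qed.

Lemma powRDr (x a b : R) : 0 < x -> x `^ (a + b) = x `^ a * x `^ b.
Proof. by move=> x0; rewrite powRD// (gt_eqF x0) implybT. Qed.

Lemma powRV (x a : R) : 0 <= x -> (x^-1) `^ a = (x `^ a)^-1.
Proof. by move=> x0; rewrite -powR_inv1// -powRrM mulN1r powRN. Qed.

Lemma powR_div (x y a : R) : 0 <= x -> 0 <= y -> (x / y) `^ a = x `^ a / y `^ a.
Proof. by move=> x0 y0; rewrite powRM ?invr_ge0// powRV. Qed.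

Lemma powR_homo (a x y : R) : 0 <= a -> 0 <= x -> x <= y -> x `^ a <= y `^ a.
Proof. by move=> a0 x0 xy; rewrite ge0_ler_powR// nnegrE// (le_trans x0). Qed.

Lemma powR_sqr (x a : R) : 0 <= x -> (x ^+ 2) `^ a = x `^ (2 * a).
Proof. by move=> x0; rewrite -powR_mulrn// -powRrM. Qed.

End Tools.

(** * The Gamma function *)

Section GammaFunction.
Variable R : realType.
Local Notation mu := (@lebesgue_measure R).

Lemma continuous_powR_gt0 (a x : R) : 0 < x -> {for x, continuous (fun y : R => y `^ a)}.
Proof.
move=> x0; apply: differentiable_continuous; apply/derivable1_diffP.
by apply: derivable_powR; rewrite in_itv/= x0.
Qed.

Definition gamma_dens (a x : R) : R := x `^ (a - 1) * expR (- x).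

Lemma gamma_dens_ge0 (a x : R) : 0 <= gamma_dens a x.
Proof. by rewrite mulr_ge0 ?powR_ge0 ?expR_ge0. Qed.

Lemma continuous_gamma_dens (a x : R) : 0 < x -> {for x, continuous (gamma_dens a)}.
Proof.
move=> x0; apply: cvgM; first exact: continuous_powR_gt0.
by apply: continuous_comp; [exact: opp_continuous | exact: continuous_expR].
Qed.

Lemma measurable_gamma_dens (a : R) (D : set R) : measurable_fun D (gamma_dens a).
Proof.
apply: measurable_funTS; apply: measurable_funM; first exact: measurable_powR.
by apply: measurableT_comp => //; exact: measurable_expR.
Qed.

(** An exhaustion by compact segments on which the fundamental theorem of calculus applies; starting
    at 2 makes every left endpoint strictly smaller than the right one. *)
Lemma itv0y_bigcup : `]0, +oo[%classic = \bigcup_n `[(n.+2%:R : R)^-1, n.+2%:R]%classic.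
Proof.
apply/seteqP; split=> x /=; rewrite in_itv/= ?andbT; last first.
  by move=> [n _] /=; rewrite in_itv/= => /andP[h _]; apply: lt_le_trans h; rewrite invr_gt0.
move=> x0; have h := archi_boundP (ltW x0).
have h' : x^-1 < (Num.bound x^-1)%:R by apply: archi_boundP; rewrite invr_ge0 ltW.
exists (Num.bound x + Num.bound x^-1)%N => //=; rewrite in_itv/=; apply/andP; split.
  rewrite invf_ple ?posrE//; apply: le_trans (ltW h') _.
  by rewrite ler_nat; apply: leq_trans (leq_addl _ _) _; do 2 apply: leqW.
apply: le_trans (ltW h) _.
by rewrite ler_nat; apply: leq_trans (leq_addr _ _) _; do 2 apply: leqW.
Qed.

Lemma cvg_integral_itv0y (f : R -> R) : measurable_fun setT f ->
  (forall x, 0 <= f x) ->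
  (\int[mu]_(x in `[(n.+2%:R : R)^-1%R, n.+2%:R%R]) (f x)%:E @[n --> \oo] -->
   \int[mu]_(x in `]0%R, +oo[) (f x)%:E)%E.
Proof.
move=> mf f0; rewrite itv0y_bigcup; apply: ge0_nondecreasing_set_cvg_integral.
- move=> n m nm; apply/subsetPset => x /=; rewrite !in_itv/= => /andP[h1 h2].
  apply/andP; split.
    by apply: le_trans h1; rewrite lef_pV2 ?posrE// ler_nat.
  by apply: le_trans h2 _; rewrite ler_nat.
- by move=> n; exact: measurable_itv.
- by move=> n; apply/measurable_EFinP; exact: measurable_funTS.
- by move=> n x _; rewrite lee_fin.
Qed.

Lemma FTC2_segment (f F : R -> R) (a b : R) : 0 < a -> a < b ->
  (forall x : R, 0 < x -> is_derive x 1 F (f x)) ->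
  (forall x : R, 0 < x -> {for x, continuous f}) ->
  (\int[mu]_(x in `[a, b]) (f x)%:E = (F b - F a)%:E)%E.
Proof.
move=> a0 ab dF cf.
have cF (x : R) : 0 < x -> {for x, continuous F}.
  move=> x0; apply: differentiable_continuous; apply/derivable1_diffP.
  by have := dF x x0; case.
have pos (x : R) : a <= x -> 0 < x by exact: lt_le_trans.
rewrite (@continuous_FTC2 _ f F)//.
- by apply: continuous_in_subspaceT => x /set_mem/=; rewrite in_itv/= => /andP[+ _] => /pos/cf.
- split.
  + by move=> x; rewrite in_itv/= => /andP[/ltW/pos/dF[]].
  + by apply: cvg_at_right_filter; exact: cF.
  + by apply: cvg_at_left_filter; apply: cF; exact: lt_trans ab.
- move=> x; rewrite in_itv/= => /andP[/ltW/pos x0 _].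
  by have := dF x x0 => H; rewrite derive1E; apply: derive_val.
Qed.

Definition gamma_integral (a : R) : \bar R :=
  (\int[mu]_(x in `]0%R, +oo[) (gamma_dens a x)%:E)%E.

(** The density is dominated by [K] times the derivative of [F = - 1 / (1 + x^a)], a function with
    values in [-1, 0]; so its integral over every segment of the exhaustion is at most [K]. *)
Lemma gamma_integral_lty (a : R) : 0 < a -> (gamma_integral a < +oo)%E.
Proof.
move=> a0.
pose F (x : R) := - (1 + x `^ a)^-1.
pose f (x : R) := a * x `^ (a - 1) / (1 + x `^ a) ^+ 2.
(* The value of [K] comes from (1 + x^a)^2 <= 2 + 2 x^(2a), with x^(2a) bounded by [powR_le_expR]
   and the constant 2 by 2 e^x. *)
pose K := 2 * (1 + (2 * a + 1) `^ (2 * a)) / a.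
have dpos (x : R) : 0 < 1 + x `^ a by rewrite ltr_pwDl// powR_ge0.
have K0 : 0 <= K.
  by rewrite /K divr_ge0// ?mulr_ge0// ?addr_ge0 ?powR_ge0// ltW.
have dF (x : R) : 0 < x -> is_derive x 1 F (f x).
  move=> x0; have := is_derive1_powR a x0 => H.
  have H1 : is_derive x 1 (fun y : R => 1 + y `^ a) (a * x `^ (a - 1)).
    by have := is_deriveD (is_derive_cst (1 : R) x 1) H; rewrite add0r.
  have H2 := is_deriveN (@is_deriveV _ (fun y : R => 1 + y `^ a) _ _ _ (lt0r_neq0 (dpos x)) H1).
  by apply: (is_derive_eq H2); rewrite /f scaleNr opprK /GRing.scale/= mulrC.
have cf (x : R) : 0 < x -> {for x, continuous f}.
  move=> x0; apply: cvgM.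
    by apply: cvgM; [exact: cvg_cst | exact: continuous_powR_gt0].
  apply: cvgV; first by rewrite sqrf_eq0 gt_eqF.
  have cD : {for x, continuous (fun y : R => 1 + y `^ a)}.
    by apply: cvgD; [exact: cvg_cst | exact: continuous_powR_gt0].
  by apply: cvgM; exact: cD.
have le (x : R) : 0 < x -> gamma_dens a x <= K * f x.
  move=> x0; rewrite /gamma_dens /K /f expRN.
  rewrite (_ : _ * _ / a * _ = x `^ (a - 1) * ((2 * (1 + (2 * a + 1) `^ (2 * a))) / (1 + x `^ a) ^+ 2)); last first.
    by field; rewrite !gt_eqF.
  rewrite ler_wpM2l ?powR_ge0// ler_pdivlMr ?exprn_gt0// ler_pdivrMl ?expR_gt0//.
  have := @powR_le_expR R (2 * a) x.
  rewrite mulrC powRrM [(x `^ a) `^ 2]powR_mulrn ?powR_ge0//.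
  move=> /(_ (mulr_ge0 (ltW a0) (ler0n _ 2)) x0) H.
  have e1 : 1 <= expR x by have := expR_ge1Dx x; lra.
  have sq : (1 + x `^ a) ^+ 2 <= 2 + 2 * (x `^ a) ^+ 2.
    by have := sqr_ge0 (1 - x `^ a); rewrite !expr2; lra.
  by apply: le_trans sq _; rewrite mulrCA mulrDr; lra.
have ub n : (\int[mu]_(x in `[(n.+2%:R : R)^-1%R, n.+2%:R%R]) (gamma_dens a x)%:E <= K%:E)%E.
  have n1 : (n.+2%:R : R)^-1 < n.+2%:R.
    apply: (@lt_trans _ _ 1); last by rewrite ltr1n.
    by rewrite invf_lt1// ltr1n.
  apply: (@le_trans _ _ (\int[mu]_(x in `[(n.+2%:R : R)^-1%R, n.+2%:R%R]) (K * f x)%:E)%E).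
    apply: ge0_le_integral_nonmeas => x /=.
      by rewrite lee_fin gamma_dens_ge0.
    rewrite in_itv/= => /andP[h _]; rewrite lee_fin; apply: le.
    by apply: lt_le_trans h; rewrite invr_gt0.
  have n0 : 0 < (n.+2%:R : R)^-1 by rewrite invr_gt0.
  have dKF (x : R) : 0 < x -> is_derive x 1 (fun y => K * F y) (K * f x).
    by move=> x0; have H2 := is_deriveZ K (dF x x0); apply: (is_derive_eq H2).
  have cKf (x : R) : 0 < x -> {for x, continuous (fun y => K * f y)}.
    by move=> x0; apply: cvgM; [exact: cvg_cst | exact: cf].
  rewrite (FTC2_segment n0 n1 dKF cKf) lee_fin -mulrBr -[leRHS]mulr1 ler_wpM2l// /F opprK.
  have : (0 : R) <= (1 + n.+2%:R `^ a)^-1 by rewrite invr_ge0 ltW.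
  have : (1 + n.+2%:R^-1 `^ a)^-1 <= 1 by rewrite invf_le1// lerDl powR_ge0.
  lra.
apply: (@le_lt_trans _ _ K%:E); last exact: ltry.
have := @cvg_integral_itv0y (gamma_dens a) (measurable_gamma_dens a (D:=_)) (gamma_dens_ge0 a).
rewrite /gamma_integral => /cvg_lim <-//; apply: lime_le; last exact: nearW.
by apply/cvg_ex; eexists; apply: cvg_integral_itv0y; [exact: measurable_gamma_dens|exact: gamma_dens_ge0].
Qed.

(** On [1, 2] the logarithm lies in [0, 1], so the density is at least e^(-|a-1|) e^(-2) there. *)
Lemma gamma_integral_gt0 (a : R) : (0 < gamma_integral a)%E.
Proof.
pose c := expR (- `|a - 1| - 2).
have c0 : (0 < c%:E)%E by rewrite lte_fin expR_gt0.
apply: lt_le_trans c0 _.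
apply: (@le_trans _ _ (\int[mu]_(x in `[1%R, 2%R]) (gamma_dens a x)%:E)%E).
  apply: (@le_trans _ _ (\int[mu]_(x in `[1%R, 2%R]) (cst c%:E x))%E).
    rewrite integral_cst//= lebesgue_measure_itv/= lte_fin ltr1n/=.
    by rewrite -EFinD -EFinM lee_fin (_ : 2 - 1 = 1 :> R) ?mulr1//; lra.
  apply: ge0_le_integral_nonmeas => x /=; first by rewrite lee_fin expR_ge0.
  rewrite in_itv/= => /andP[x1 x2]; rewrite lee_fin /gamma_dens /c expRD.
  have x0 : 0 < x by lra.
  apply: ler_pM; rewrite ?expR_ge0// ?ler_expR; last by rewrite lerN2.
  rewrite /powR gt_eqF// ler_expR.
  have l0 : 0 <= ln x by rewrite ln_ge0.
  have l1 : ln x <= 1 by have := ln_le_subr1 x0; lra.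
  have : - `|a - 1| <= a - 1 by rewrite lerNl -normrN ler_norm.
  have := normr_ge0 (a - 1); nra.
apply: ge0_subset_integral => //=.
- by apply/measurable_EFinP; exact: measurable_gamma_dens.
- by move=> x _; rewrite lee_fin gamma_dens_ge0.
- by move=> x /=; rewrite !in_itv/= => /andP[x1 _]; rewrite andbT; lra.
Qed.

Lemma cvg_invnS2_at_right0 : (n.+2%:R^-1 : R) @[n --> \oo] --> (0 : R)^'+.
Proof.
move=> A; rewrite /at_right /within/= => HA.
have : (n.+2%:R^-1 : R) @[n --> \oo] --> (0 : R).
  by have := @cvg_harmonic R; rewrite -cvg_shiftS.
move=> /(_ _ HA) [N _ HN]; exists N => // n /= Nn; exact: HN.
Qed.

(** Integration by parts on each segment of the exhaustion; [b n] is the boundary term, and it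
    vanishes in the limit at both ends. *)
Lemma gamma_integralS (a : R) : 0 < a -> gamma_integral (a + 1) = (a%:E * gamma_integral a)%E.
Proof.
move=> a0.
pose b (n : nat) : R := - (n.+2%:R `^ a * expR (- n.+2%:R)) + n.+2%:R^-1 `^ a * expR (- n.+2%:R^-1).
have parts n : (\int[mu]_(x in `[(n.+2%:R : R)^-1%R, n.+2%:R%R]) (gamma_dens (a + 1) x)%:E =
   (b n)%:E + a%:E * \int[mu]_(x in `[(n.+2%:R : R)^-1%R, n.+2%:R%R]) (gamma_dens a x)%:E)%E.
  have n0 : 0 < (n.+2%:R : R)^-1 by rewrite invr_gt0.
  have n1 : (n.+2%:R : R)^-1 < n.+2%:R.
    apply: (@lt_trans _ _ 1); last by rewrite ltr1n.
    by rewrite invf_lt1// ltr1n.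
  pose F (x : R) := x `^ a * expR (- x).
  pose f (x : R) := a * gamma_dens a x - gamma_dens (a + 1) x.
  have dF (x : R) : 0 < x -> is_derive x 1 F (f x).
    move=> x0; have H := is_derive1_powR a x0.
    have H2 : is_derive x 1 (fun y : R => expR (- y)) (- expR (- x)).
      have H3 := @is_derive1_comp _ expR (fun y => - y) x _ _ (is_derive_expR _) (is_deriveN (is_derive_id x 1)).
      by apply: (is_derive_eq H3); rewrite mulrN1.
    apply: (is_derive_eq (is_deriveM H H2)).
    by rewrite /f /gamma_dens /GRing.scale/= addrK; ring.
  have cf (x : R) : 0 < x -> {for x, continuous f}.
    move=> x0; apply: cvgB; last exact: continuous_gamma_dens.
    by apply: cvgM; [exact: cvg_cst|exact: continuous_gamma_dens].
  have ig c : mu.-integrable `[(n.+2%:R : R)^-1%R, n.+2%:R%R] (EFin \o gamma_dens c).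
    apply: continuous_compact_integrable; first exact: segment_compact.
    apply: continuous_in_subspaceT => x /set_mem/=; rewrite in_itv/= => /andP[h _].
    by apply: continuous_gamma_dens; apply: lt_le_trans h.
  have := FTC2_segment n0 n1 dF cf.
  rewrite /f; under eq_integral do rewrite EFinB EFinM.
  have i1 : mu.-integrable `[(n.+2%:R : R)^-1%R, n.+2%:R%R] (fun x => a%:E * (gamma_dens a x)%:E)%E.
    by apply: integrableZl => //; exact: ig.
  rewrite (integralB _ i1 (ig (a + 1)))// (integralZl _ (ig a))//=.
  move=> E.
  have fin c : (\int[mu]_(x in `[(n.+2%:R : R)^-1%R, n.+2%:R%R]) (gamma_dens c x)%:E)%E \is a fin_num.
    by apply: integrable_fin_num => //; exact: ig.
  move: E; rewrite -(fineK (fin a)) -(fineK (fin (a + 1))) -EFinM -EFinB -EFinD => -[E].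
  by congr EFin; move: E; rewrite /b /F; lra.
have b0 : b n @[n --> \oo] --> 0.
  rewrite -[X in _ --> X](_ : - 0 + 0 * expR (- 0) = 0 :> R); last by rewrite mul0r oppr0 addr0.
  apply: cvgD; last first.
    apply: cvgM; first exact: cvg_comp cvg_invnS2_at_right0 (powR_cvg0 a0).
    apply: (cvg_comp (fun n : nat => n.+2%:R^-1 : R) (fun x : R => expR (- x))).
      by apply: cvg_trans cvg_invnS2_at_right0 _; exact: cvg_within.
    by apply: continuous_comp; [exact: opp_continuous|exact: continuous_expR].
  apply: cvgN.
  (* With exponent [a + 1], [powR_le_expR] gives x^a e^(-x) <= C / x, hence the boundary term at n +
     2 is at most C / (n + 2). *)
  pose C := (a + 1 + 1) `^ (a + 1).
  have h : (C * (n.+2%:R^-1 : R)) @[n --> \oo] --> (0 : R).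
    rewrite -[X in _ --> X](mulr0 C); apply: cvgM; first exact: cvg_cst.
    by apply: cvg_trans cvg_invnS2_at_right0 _; exact: cvg_within.
  apply: (squeeze_cvgr _ (cvg_cst 0) h).
  apply: nearW => n; rewrite mulr_ge0 ?powR_ge0 ?expR_ge0//=.
  have := @powR_le_expR R (a + 1) n.+2%:R.
  rewrite powRDr// powRr1// => /(_ _ _) H.
  rewrite expRN ler_pdivrMr ?expR_gt0// mulrAC ler_pdivlMr// /C.
  by apply: H => //; lra.
have L1 := @cvg_integral_itv0y (gamma_dens (a + 1)) (measurable_gamma_dens (a + 1) (D:=_)) (gamma_dens_ge0 (a + 1)).
have L2 := @cvg_integral_itv0y (gamma_dens a) (measurable_gamma_dens a (D:=_)) (gamma_dens_ge0 a).
have L3 : (((b n)%:E + a%:E * \int[mu]_(x in `[(n.+2%:R : R)^-1%R, n.+2%:R%R]) (gamma_dens a x)%:E)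
   @[n --> \oo] --> 0%:E + a%:E * gamma_integral a)%E.
  apply: cvgeD; first by rewrite fin_num_adde_defr.
    by apply/cvg_EFin => //; exact: nearW.
  by apply: cvgeZl.
rewrite -[RHS]add0e.
apply: (cvg_unique _ L1); first exact: ereal_hausdorff.
by rewrite (funext parts); exact: L3.
Qed.

Lemma GammaE (a : R) : Gamma a = fine (gamma_integral a).
Proof. by []. Qed.

(** Since [fine] sends an infinite value to 0, positivity rests on the finiteness of the integral as
    well as on its positivity. *)
Lemma Gamma_gt0 (a : R) : 0 < a -> 0 < Gamma a.
Proof. by move=> a0; rewrite GammaE fine_gt0// gamma_integral_gt0 gamma_integral_lty. Qed.

Lemma GammaS (a : R) : 0 < a -> Gamma (a + 1) = a * Gamma a.
Proof.
move=> a0; rewrite !GammaE gamma_integralS// fineM//.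
by rewrite ge0_fin_numE ?gamma_integral_lty// ltW// gamma_integral_gt0.
Qed.

End GammaFunction.

(** * Bounds for the Bessel function and the Gaussian kernel *)

Section Bessel.
Variable R : realType.
Implicit Types (z x w : R).

(** The rising factorial of z + 1/2, that is Gamma(k + z + 1/2) / Gamma(z + 1/2). *)
Definition half_poch z (k : nat) : R := \prod_(j < k) (j%:R + 2^-1 + z).

Lemma half_pochS z k : half_poch z k.+1 = half_poch z k * (k%:R + 2^-1 + z).
Proof. by rewrite /half_poch big_ord_recr. Qed.

Lemma half_poch_gt0 z k : 0 <= z -> 0 < half_poch z k.
Proof.
by move=> z0; apply: prodr_gt0 => j _; have := ler0n R j; lra.
Qed.

Lemma Gamma_half_poch z k : 0 <= z ->
  Gamma (k%:R + (z - 2^-1) + 1) = half_poch z k * Gamma (z + 2^-1).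
Proof.
move=> z0; elim: k => [|k IH].
  by rewrite /half_poch big_ord0 mul1r; congr Gamma; lra.
rewrite (_ : k.+1%:R + _ + 1 = (k%:R + (z - 2^-1) + 1) + 1); last by rewrite -[k.+1%:R]natr1; ring.
have k0 := ler0n R k.
rewrite GammaS; last by lra.
rewrite IH half_pochS (_ : k%:R + (z - 2^-1) + 1 = k%:R + 2^-1 + z); first by ring.
by lra.
Qed.

(** The duplication formula in product form. It explains why [z = 0] is the reference case: there
    the Bessel series is the even part of an exponential series. *)
Lemma fact_half_poch0 (k : nat) : k`!%:R * half_poch 0 k * 4 ^+ k = ((2 * k)`!)%:R.
Proof.
elim: k => [|k IH]; first by rewrite /half_poch big_ord0 muln0 !mulr1.
rewrite half_pochS factS mulnS !addSn add0n !factS !natrM -IH exprS.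
by rewrite -[k.+1%:R]natr1 -[(2 * k).+2%:R]natr1 -[(2 * k).+1%:R]natr1 natrM; field.
Qed.

(** With d = c + z, one has c = d (1 - z/d) <= d e^(-z/d) and (d + 1)^z <= e^(z/d) d^z, and the
    exponentials cancel. This is the induction step of [half_poch_lower], with c = k + 1/2. *)
Lemma powR_ratio_lower (c z : R) : 0 < c -> 0 <= z ->
  c * (c + 1 + z) `^ z <= (c + z) * (c + z) `^ z.
Proof.
move=> c0 z0; have d0 : 0 < c + z by rewrite ltr_wpDr.
have e0 : 0 < c + 1 + z by lra.
have h1 : c <= (c + z) * expR (- (z / (c + z))).
  have := expR_ge1Dx (- (z / (c + z))) => H.
  have : (c + z) * (1 - z / (c + z)) <= (c + z) * expR (- (z / (c + z))) by rewrite ler_pM2l.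
  by rewrite [X in X <= _](_ : _ = c)//; field; rewrite gt_eqF.
have h2 : (c + 1 + z) `^ z <= expR (z / (c + z)) * (c + z) `^ z.
  rewrite /powR !gt_eqF// -expRD ler_expR.
  have -> : ln (c + 1 + z) = ln (c + z) + ln ((c + 1 + z) / (c + z)).
    by rewrite -lnM ?posrE ?divr_gt0// mulrC divfK ?gt_eqF.
  rewrite mulrDr addrC lerD2r ler_wpM2l//.
  have := ln_le_subr1 (divr_gt0 e0 d0).
  by rewrite [X in _ <= X -> _](_ : _ = (c + z)^-1)//; field; rewrite gt_eqF.
apply: le_trans (ler_pM (ltW c0) (powR_ge0 _ _) h1 h2) _.
by rewrite mulrA -(mulrA (c + z)) -expRD addNr expR0 mulr1.
Qed.

(** The same cancellation around c: c + z <= c e^(z/c) and (c - 1)^z <= e^(-z/c) c^z. This is the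
    induction step of [half_poch_upper], with c = k + 3/2. *)
Lemma powR_ratio_upper (c z : R) : 1 < c -> 0 <= z ->
  (c + z) * (c - 1) `^ z <= c * c `^ z.
Proof.
move=> c1 z0; have c0 : 0 < c by lra.
have d0 : 0 < c - 1 by lra.
have h1 : c + z <= c * expR (z / c).
  have := expR_ge1Dx (z / c) => H.
  have : c * (1 + z / c) <= c * expR (z / c) by rewrite ler_pM2l.
  by rewrite [X in X <= _](_ : _ = c + z)//; field; rewrite gt_eqF.
have h2 : (c - 1) `^ z <= expR (- (z / c)) * c `^ z.
  rewrite /powR !gt_eqF// -expRD ler_expR.
  have -> : ln (c - 1) = ln c + ln ((c - 1) / c).
    by rewrite -lnM ?posrE ?divr_gt0// mulrC divfK ?gt_eqF.
  rewrite mulrDr addrC lerD2r -mulrN ler_wpM2l//.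
  have := ln_le_subr1 (divr_gt0 d0 c0).
  by rewrite [X in _ <= X -> _](_ : _ = - c^-1)//; field; rewrite gt_eqF.
have cz : 0 <= c + z by lra.
apply: le_trans (ler_pM cz (powR_ge0 _ _) h1 h2) _.
by rewrite mulrA -(mulrA c) -expRD subrr expR0 mulr1.
Qed.

Lemma half_poch_lower z k : 0 <= z ->
  half_poch 0 k * k.+1%:R `^ z <= (1 + 2 * z) `^ z * half_poch z k.
Proof.
move=> z0.
(* The base k + 1/2 + z, rather than k + 1, makes the induction close exactly through the ratio
   lemma; twice this base is at least k + 1, which accounts for the factor 2^z multiplied in
   below. *)
have H : half_poch 0 k * (k%:R + 2^-1 + z) `^ z <= (2^-1 + z) `^ z * half_poch z k.
  elim: k => [|k IH]; first by rewrite /half_poch !big_ord0 mul1r mulr1 add0r.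
  rewrite !half_pochS addr0 -[k.+1%:R]natr1.
  have c0 : 0 < k%:R + 2^-1 :> R by rewrite ltr_pwDr// invr_gt0.
  have := powR_ratio_lower c0 z0.
  rewrite (_ : k%:R + 2^-1 + 1 + z = k%:R + 1 + 2^-1 + z); last by ring.
  move=> /(ler_wpM2l (ltW (half_poch_gt0 k (lexx 0)))).
  rewrite -mulrA => h; apply: le_trans h _.
  rewrite mulrCA [leRHS]mulrA [leRHS]mulrC ler_wpM2l//.
  by have := ler0n R k; lra.
have := ler_wpM2l (powR_ge0 2 z) H.
rewrite [2 `^ z * ((2^-1 + z) `^ z * _)]mulrA -powRM ?addr_ge0 ?invr_ge0//.
rewrite [2 * (2^-1 + z)]mulrDr mulfV ?pnatr_eq0//.
apply: le_trans; rewrite mulrCA ler_wpM2l ?(ltW (half_poch_gt0 _ (lexx 0)))//.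
rewrite -powRM//; last by rewrite !addr_ge0 ?invr_ge0.
by apply: powR_homo => //; rewrite -[k.+1%:R]natr1; have := ler0n R k; lra.
Qed.

Lemma half_poch_upper z k : 0 <= z ->
  half_poch z k <= (1 + 2 * z) * 2 `^ z * k.+1%:R `^ z * half_poch 0 k.
Proof.
move=> z0.
have c1 : 1 <= (1 + 2 * z) * 2 `^ z.
  rewrite -[leLHS]mulr1; apply: ler_pM => //; first lra.
  by rewrite -[leLHS](powRr0 (2 : R)); apply: ler_powR => //; rewrite ler1n.
(* The induction starts at index one: the natural base, index minus 1/2, is negative at index
   zero. *)
case: k => [|k].
  by rewrite /half_poch !big_ord0 powR1 !mulr1.
have H : half_poch z k.+1 <= (1 + 2 * z) * 2 `^ z * (k%:R + 2^-1) `^ z * half_poch 0 k.+1.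
  elim: k => [|k IH].
    rewrite !half_pochS /half_poch !big_ord0 !mul1r !add0r addr0.
    rewrite -(mulrA (1 + 2 * z)) -powRM ?invr_ge0// mulfV ?pnatr_eq0// powR1; lra.
  rewrite half_pochS [in leRHS]half_pochS addr0 -[k.+1%:R]natr1.
  have c0 : 1 < k%:R + 1 + 2^-1 :> R by have := ler0n R k; lra.
  have := powR_ratio_upper c0 z0.
  rewrite (_ : k%:R + 1 + 2^-1 - 1 = k%:R + 2^-1); last by ring.
  move=> h; have d0 : 0 <= k%:R + 1 + 2^-1 + z by have := ler0n R k; lra.
  apply: le_trans (ler_wpM2r d0 IH) _.
  set a := (_ * 2 `^ z) in c1 *.
  rewrite [leLHS](_ : _ = a * half_poch 0 k.+1 * ((k%:R + 1 + 2^-1 + z) * (k%:R + 2^-1) `^ z)); last by ring.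
  rewrite [leRHS](_ : _ = a * half_poch 0 k.+1 * ((k%:R + 1 + 2^-1) * (k%:R + 1 + 2^-1) `^ z)); last by ring.
  by rewrite ler_wpM2l// mulr_ge0 ?(le_trans ler01 c1)// ltW// half_poch_gt0.
apply: le_trans H _; rewrite ler_wpM2r ?(ltW (half_poch_gt0 _ (lexx 0)))// ler_wpM2l//.
  exact: le_trans c1.
by apply: powR_homo; rewrite // -[k.+2%:R]natr1 -[k.+1%:R]natr1; have := ler0n R k; lra.
Qed.

Definition bessel_term z x (k : nat) : R :=
  (x / 2) `^ (2 * k%:R + (z - 2^-1)) / (k`!%:R * Gamma (k%:R + (z - 2^-1) + 1)).

(** The duplication formula merges k! and 4^k into (2k)!, so each term is an even exponential
    coefficient times a ratio of rising factorials, and only this ratio depends on both [z] and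
    [k]. *)
Lemma bessel_termE z x k : 0 <= z -> 0 < x ->
  bessel_term z x k = (x / 2) `^ (z - 2^-1) / Gamma (z + 2^-1) *
    (x ^+ (2 * k) / (2 * k)`!%:R * (half_poch 0 k / half_poch z k)).
Proof.
move=> z0 x0; have x20 : 0 < x / 2 by rewrite divr_gt0.
rewrite /bessel_term Gamma_half_poch// -fact_half_poch0 (powRDr (2 * k%:R))//.
rewrite -natrM powR_mulrn ?(ltW x20)// expr_div_n.
rewrite [X in _ / X * _](_ : 2 ^+ (2 * k) = 4 ^+ k :> R); last first.
  by rewrite exprM; congr (_ ^+ _); rewrite expr2; lra.
have G0 : Gamma (z + 2^-1) != 0 by rewrite gt_eqF// Gamma_gt0//; lra.
field.
rewrite G0 !gt_eqF ?half_poch_gt0// ?exprn_gt0// ltr0n fact_gt0//.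
Qed.

Lemma half_poch_ratio z : 0 <= z ->
  exists c C : R, [/\ 0 < c, 0 < C & forall k,
    c / k.+1%:R `^ z <= half_poch 0 k / half_poch z k <= C / k.+1%:R `^ z].
Proof.
move=> z0; have a0 : 0 < (1 + 2 * z) * 2 `^ z by rewrite mulr_gt0 ?powR_gt0//; lra.
have b0 : 0 < (1 + 2 * z) `^ z by rewrite powR_gt0//; lra.
exists ((1 + 2 * z) * 2 `^ z)^-1, ((1 + 2 * z) `^ z); split => //; first by rewrite invr_gt0.
move=> k; have k0 : 0 < k.+1%:R `^ z :> R by rewrite powR_gt0.
apply/andP; split.
  rewrite -invfM ler_pdivlMr ?half_poch_gt0// ler_pdivrMl; last by rewrite mulr_gt0.
  exact: half_poch_upper.
by rewrite ler_pdivrMr ?half_poch_gt0// mulrAC ler_pdivlMr//; exact: half_poch_lower.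
Qed.

(** From ln v <= v - 1 at v = (k + 1) / (1 + x). It trades the polynomial weight in k for the power
    of 1 + x wanted in the end, at the price of a factor geometric in k. *)
Lemma powR_succ_le z x (k : nat) : 0 <= z -> 0 < x ->
  k.+1%:R `^ z <= (1 + x) `^ z * expR (z * k%:R / (1 + x)).
Proof.
move=> z0 x0; have y0 : 0 < 1 + x by lra.
rewrite /powR !gt_eqF// -expRD ler_expR.
have k0 : 0 < k.+1%:R :> R by [].
have -> : ln k.+1%:R = ln (1 + x) + ln (k.+1%:R / (1 + x)).
  by rewrite -lnM ?posrE ?divr_gt0// mulrC divfK ?gt_eqF.
rewrite mulrDr lerD2l -mulrA ler_wpM2l//.
apply: le_trans (ln_le_subr1 (divr_gt0 k0 y0)) _.
by rewrite lerBlDr ler_pdivrMr// mulrDl divfK ?gt_eqF// mul1r -natr1; lra.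
Qed.

(** The geometric factor of [powR_succ_le] is the inverse of a 2k-th power, so it is absorbed by
    shrinking the argument of the exponential series. *)
Lemma even_term_lower z x (k : nat) : 0 <= z -> 0 < x ->
  exp_coeff (x * expR (- (z / (2 * (1 + x))))) (2 * k)%N / (1 + x) `^ z <=
  exp_coeff x (2 * k)%N / k.+1%:R `^ z.
Proof.
move=> z0 x0; have y0 : 0 < 1 + x by lra.
rewrite /exp_coeff/= exprMn -expRM_natl.
rewrite (_ : _ * - _ = - (z * k%:R / (1 + x))); last first.
  by rewrite natrM; field; rewrite gt_eqF.
have := powR_succ_le k z0 x0.
set E := expR (z * _ / _) => H.
rewrite expRN -/E -!mulrA ler_wpM2l ?exprn_ge0 ?(ltW x0)//.
rewrite [leLHS]mulrCA ler_wpM2l ?invr_ge0// -invfM lef_pV2 ?posrE ?mulr_gt0 ?powR_gt0 ?expR_gt0//.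
by rewrite mulrC.
Qed.

Lemma fact_add_le (m n : nat) : ((m + n)`! <= m`! * (m + n) ^ n)%N.
Proof.
elim: n => [|n IH]; first by rewrite addn0 expn0 muln1.
rewrite addnS factS expnS mulnCA leq_mul2l; apply/orP; right.
apply: leq_trans IH _; rewrite leq_mul2l; apply/orP; right.
by case: n => // n; rewrite leq_exp2r.
Qed.

(** For v = (1 + x) / (k + 1), v^z <= 1 + v^n because z <= n. The integer power v^n only shifts the
    index of the exponential coefficient by n, since (2k + n)! <= (2k)! (2k + n)^n and 2k + n <= (n
    + 2)(k + 1). *)
Lemma even_term_upper z x (n k : nat) : 0 <= z -> z <= n%:R -> 0 < x ->
  exp_coeff x (2 * k)%N / k.+1%:R `^ z <=
  (exp_coeff (1 + x) (2 * k + 0)%N + n.+2%:R ^+ n * exp_coeff (1 + x) (2 * k + n)%N) / (1 + x) `^ z.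
Proof.
move=> z0 zn x0; have y0 : 0 < 1 + x by lra.
have k0 : 0 < k.+1%:R :> R by [].
have v0 : 0 < (1 + x) / k.+1%:R by rewrite divr_gt0.
have hv : ((1 + x) / k.+1%:R) `^ z <= 1 + ((1 + x) / k.+1%:R) ^+ n.
  case: (leP ((1 + x) / k.+1%:R) 1) => v1.
    apply: (@le_trans _ _ 1); last by rewrite lerDl exprn_ge0// ltW.
    by have := powR_homo z0 (ltW v0) v1; rewrite powR1.
  rewrite -powR_mulrn ?(ltW v0)//; apply: (@le_trans _ _ (((1 + x) / k.+1%:R) `^ n%:R)).
    by apply: ler_powR => //; exact: ltW.
  by rewrite lerDr.
have hf : ((2 * k + n)`!)%:R <= n.+2%:R ^+ n * (((2 * k)`!)%:R * k.+1%:R ^+ n) :> R.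
  rewrite -!natrX -!natrM ler_nat; apply: leq_trans (fact_add_le _ _) _.
  rewrite mulnCA leq_mul2l -expnMn; apply/orP; right.
  case: n {zn hv} => // n; rewrite leq_exp2r//.
  by rewrite mulnS mulSn mulSn; lia.
rewrite powR_div ?(ltW y0)// in hv.
rewrite ler_pdivlMr ?powR_gt0// mulrAC -mulrA.
apply: (@le_trans _ _ (exp_coeff x (2 * k)%N * (1 + ((1 + x) / k.+1%:R) ^+ n))).
  by rewrite ler_wpM2l// exp_coeff_ge0// ltW.
rewrite mulrDr mulr1 addn0 /exp_coeff/=.
have xy : x ^+ (2 * k) <= (1 + x) ^+ (2 * k) by rewrite lerXn2r// ?nnegrE; lra.
have F0 : 0 < ((2 * k)`!)%:R :> R by rewrite ltr0n fact_gt0.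
have F1 : 0 < ((2 * k + n)`!)%:R :> R by rewrite ltr0n fact_gt0.
have e0 : x ^+ (2 * k) / (2 * k)`!%:R <= (1 + x) ^+ (2 * k) / (2 * k)`!%:R.
  by rewrite ler_pM2r// invr_gt0.
apply: lerD => //.
apply: le_trans (ler_wpM2r (exprn_ge0 n (ltW v0)) e0) _.
rewrite expr_div_n exprD.
rewrite [leLHS](_ : _ = (1 + x) ^+ (2 * k)%N * (1 + x) ^+ n * ((2 * k)`!%:R * k.+1%:R ^+ n)^-1); last first.
  by field; rewrite !gt_eqF// exprn_gt0.
rewrite mulrCA ler_wpM2l ?mulr_ge0 ?exprn_ge0 ?(ltW y0)//.
by rewrite -[leLHS]mul1r ler_pdivrMr ?mulr_gt0 ?exprn_gt0// mulrAC ler_pdivlMr// mul1r.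
Qed.

Lemma nondecreasing_series_exp_coeff x : 0 <= x -> nondecreasing_seq (series (exp_coeff x)).
Proof. by move=> x0; apply: nondecreasing_series => n _ _; exact: exp_coeff_ge0. Qed.

Lemma sum_exp_coeff_stride x (n N : nat) : 0 <= x ->
  \sum_(0 <= k < N) exp_coeff x (2 * k + n)%N <= expR x.
Proof.
move=> x0; apply: (@le_trans _ _ (series (exp_coeff x) (2 * N + n)%N)); last first.
  apply: nondecreasing_cvgn_le; last exact: is_cvg_series_exp_coeff.
  exact: nondecreasing_series_exp_coeff.
elim: N => [|N IH].
  by rewrite big_geq// sumr_ge0// => i _; exact: exp_coeff_ge0.
rewrite big_nat_recr//= mulnS !addSn add0n seriesSr seriesSr.
by have := exp_coeff_ge0 (2 * N + n).+1 x0; lra.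
Qed.

(** Each odd coefficient is at most the sum of its two even neighbours, so every even coefficient is
    counted at most three times; the last summand is the right neighbour of the last odd index. The
    inequality between neighbours is a quadratic in [x] settled by completing the square. *)
Lemma series_exp_coeff_le_even x (N : nat) : 0 <= x ->
  series (exp_coeff x) (2 * N)%N <=
  3 * \sum_(0 <= k < N) exp_coeff x (2 * k)%N + exp_coeff x (2 * N)%N.
Proof.
move=> x0; elim: N => [|N IH].
  by rewrite muln0 /series/= !big_geq// mulr0 add0r exp_coeff_ge0.
rewrite big_nat_recr//= mulnS !addSn add0n seriesSr seriesSr.
suff odd : exp_coeff x (2 * N).+1 <= exp_coeff x (2 * N)%N + exp_coeff x (2 * N).+2 by lra.
rewrite /exp_coeff/= !factS !natrM !exprS.
have F0 : 0 < ((2 * N)`!)%:R :> R by rewrite ltr0n fact_gt0.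
have X0 : 0 <= x ^+ (2 * N) by rewrite exprn_ge0.
set F := ((2 * N)`!)%:R in F0 *; set X := x ^+ (2 * N) in X0 *.
rewrite -[(2 * N).+2%:R]natr1 -[(2 * N).+1%:R]natr1; set m := (2 * N)%:R.
have m0 : 0 <= m by rewrite ler0n.
rewrite -subr_ge0.
rewrite [leRHS](_ : _ = X / F * ((m + 1 + 1) * (m + 1) - x * (m + 1 + 1) + x * x) / ((m + 1 + 1) * (m + 1))); last first.
  by field; rewrite !gt_eqF//; lra.
rewrite divr_ge0//; last by rewrite mulr_ge0; lra.
rewrite mulr_ge0// ?divr_ge0 ?(ltW F0)//.
by have := sqr_ge0 (x - (m + 1 + 1) / 2); rewrite expr2; nra.
Qed.

Lemma besselI_bounds z : 0 <= z ->
  exists c C : R, [/\ 0 < c, 0 < C & forall x, 0 < x ->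
    c * (x `^ (z - 2^-1) / (1 + x) `^ z * expR x) <= besselI (z - 2^-1) x <=
    C * (x `^ (z - 2^-1) / (1 + x) `^ z * expR x)].
Proof.
move=> z0; have [c [C [c0 C0 H]]] := half_poch_ratio z0.
have G0 : 0 < Gamma (z + 2^-1) by rewrite Gamma_gt0//; lra.
pose a := (2 `^ (z - 2^-1) * Gamma (z + 2^-1))^-1.
have a0 : 0 < a by rewrite invr_gt0 mulr_gt0// powR_gt0.
pose n := Num.bound z.
have zn : z <= n%:R by apply: ltW; exact: archi_boundP.
pose N : R := n.+2%:R ^+ n.
have N0 : 0 <= N by rewrite exprn_ge0.
(* Upper constant: the two exponential series at 1 + x sum to at most (1 + N) e e^x. Lower constant:
   1/3 is the loss from keeping even indices only, e^(-z/2) the loss from shrinking the argument [x]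
   to [w]. *)
exists (a * c * expR (- (z / 2)) / 3), (a * C * (1 + N) * expR 1); split.
- by rewrite divr_gt0// !mulr_gt0// expR_gt0.
- by rewrite !mulr_gt0 ?expR_gt0//; lra.
move=> x x0; have y0 : 0 < 1 + x by lra.
have Y0 : 0 < (1 + x) `^ z by rewrite powR_gt0.
have -> : besselI (z - 2^-1) x = limn (series (bessel_term z x)) by [].
set X := x `^ (z - 2^-1); have X0 : 0 < X by rewrite powR_gt0.
have termE k : bessel_term z x k =
    a * X * (exp_coeff x (2 * k)%N * (half_poch 0 k / half_poch z k)).
  rewrite bessel_termE// powR_div ?(ltW x0)// /a invfM -/X /exp_coeff/=; ring.
have e_ge0 k : 0 <= exp_coeff x (2 * k)%N by rewrite exp_coeff_ge0// ltW.
have upper k : bessel_term z x k <= a * X * C / (1 + x) `^ z *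
    (exp_coeff (1 + x) (2 * k + 0)%N + N * exp_coeff (1 + x) (2 * k + n)%N).
  rewrite termE -!(mulrA (a * X)) ler_wpM2l ?mulr_ge0 ?(ltW a0) ?(ltW X0)//.
  have /andP[_ h2] := H k.
  apply: le_trans (ler_wpM2l (e_ge0 k) h2) _; rewrite mulrCA -mulrA ler_wpM2l ?(ltW C0)//.
  by rewrite [leRHS]mulrC; exact: even_term_upper.
pose w := x * expR (- (z / (2 * (1 + x)))).
have w0 : 0 <= w by rewrite mulr_ge0 ?expR_ge0// ltW.
have lower k : a * X * c / (1 + x) `^ z * exp_coeff w (2 * k)%N <= bessel_term z x k.
  rewrite termE -!(mulrA (a * X)) ler_wpM2l ?mulr_ge0 ?(ltW a0) ?(ltW X0)//.
  have /andP[h1 _] := H k.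
  apply: le_trans _ (ler_wpM2l (e_ge0 k) h1); rewrite [leRHS]mulrCA -mulrA ler_wpM2l ?(ltW c0)//.
  by rewrite mulrC; exact: even_term_lower.
have term_ge0 k : 0 <= bessel_term z x k.
  apply: le_trans (lower k); rewrite mulr_ge0 ?exp_coeff_ge0//.
  by rewrite divr_ge0 ?(ltW Y0)// !mulr_ge0 ?(ltW a0) ?(ltW X0) ?(ltW c0).
have nd : nondecreasing_seq (series (bessel_term z x)) by apply: nondecreasing_series.
have ub M : series (bessel_term z x) M <=
    a * C * (1 + N) * expR 1 * (X / (1 + x) `^ z * expR x).
  apply: (@le_trans _ _ (a * X * C / (1 + x) `^ z * (expR (1 + x) + N * expR (1 + x)))); last first.
    by rewrite expRD le_eqVlt; apply/orP; left; apply/eqP; field; rewrite gt_eqF.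
  rewrite /series/=; apply: le_trans (ler_sum _ (fun k _ => upper k)) _.
  rewrite -mulr_sumr big_split/= -mulr_sumr ler_wpM2l//.
    by rewrite divr_ge0 ?(ltW Y0)// !mulr_ge0 ?(ltW a0) ?(ltW X0) ?(ltW C0).
  by apply: lerD; [|rewrite ler_wpM2l//]; apply: sum_exp_coeff_stride; exact: ltW.
have cvg : cvgn (series (bessel_term z x)).
  by apply: nondecreasing_is_cvgn => //; eexists => _ [M _ <-]; exact: ub.
apply/andP; split; last by apply: limr_le => //; exact: nearW.
set L := limn _.
have sL M : series (bessel_term z x) M <= L by exact: nondecreasing_cvgn_le.
have d0 : 0 < a * X * c / (1 + x) `^ z by rewrite divr_gt0// !mulr_gt0.
(* The stray even coefficient of index 2M left by [series_exp_coeff_le_even] is absorbed by summing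
   the even terms up to M inclusive. *)
have key : a * X * c / (1 + x) `^ z * expR w <= 3 * L.
  rewrite mulrC -ler_pdivlMr//.
  apply: limr_le; first exact: is_cvg_series_exp_coeff.
  apply: nearW => M; rewrite ler_pdivlMr// mulrC.
  apply: (@le_trans _ _ (a * X * c / (1 + x) `^ z * (3 * \sum_(0 <= k < M.+1) exp_coeff w (2 * k)%N))).
    rewrite ler_pM2l//; apply: (@le_trans _ _ (series (exp_coeff w) (2 * M)%N)).
      by apply: nondecreasing_series_exp_coeff => //; rewrite mulSn leq_addr.
    apply: le_trans (series_exp_coeff_le_even _ w0) _; rewrite big_nat_recr//= mulrDr lerD2l.
    by have := exp_coeff_ge0 (2 * M)%N w0; lra.
  rewrite mulrCA ler_pM2l// mulr_sumr; apply: le_trans (sL M.+1).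
  by apply: ler_sum => k _; exact: lower.
(* The shrinking costs only a bounded amount: x - w <= x z / (2 (1 + x)) <= z / 2. *)
have wx : x - z / 2 <= w.
  have := expR_ge1Dx (- (z / (2 * (1 + x)))) => /(ler_wpM2l (ltW x0)); apply: le_trans.
  have : x * (z / (2 * (1 + x))) <= z / 2.
    rewrite mulrA ler_pdivrMr ?mulr_gt0//.
    by rewrite [leRHS](_ : _ = z + x * z); [lra|field].
  lra.
have ew : expR (- (z / 2)) * expR x <= expR w by rewrite -expRD ler_expR; lra.
have := ler_wpM2l (ltW d0) ew => /le_trans/(_ key).
set E1 := expR (- _); set E2 := expR x.
rewrite [X in X <= _ -> _](_ : _ = 3 * (a * c * E1 / 3 * (X / (1 + x) `^ z * E2))); last first.
  by field; rewrite gt_eqF.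
by rewrite ler_pM2l.
Qed.

(** Up to a constant, the one-dimensional heat kernel at time [u] times the weight (2u +
    rs)^(-z). *)
Definition heat_profile z u r s : R :=
  expR (- ((r - s) ^+ 2 / (4 * u))) / ((2 * u) `^ 2^-1 * (2 * u + r * s) `^ z).

Lemma p2_bounds z : 0 <= z ->
  exists c C : R, [/\ 0 < c, 0 < C & forall u r s : R, 0 < u -> 0 < r -> 0 < s ->
    c * heat_profile z u r s <= p2 z u r s <= C * heat_profile z u r s].
Proof.
move=> z0; have [c [C [c0 C0 H]]] := besselI_bounds z0.
exists c, C; split => // u r s u0 r0 s0.
have rs0 : 0 < r * s by rewrite mulr_gt0.
have u20 : 0 < 2 * u by rewrite mulr_gt0.
have x0 : 0 < r * s / (2 * u) by rewrite divr_gt0.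
pose P := (r * s) `^ (2^-1 - z) / (2 * u) * expR (- (r ^+ 2 + s ^+ 2) / (4 * u)).
have P0 : 0 < P by rewrite !mulr_gt0 ?expR_gt0 ?powR_gt0 ?invr_gt0.
(* At x = rs/(2u) the factor e^x completes the square in the exponent, the powers of rs cancel, and
   1 + x = (2u + rs)/(2u). *)
have E : P * ((r * s / (2 * u)) `^ (z - 2^-1) / (1 + r * s / (2 * u)) `^ z * expR (r * s / (2 * u)))
    = heat_profile z u r s.
  rewrite /P /heat_profile.
  have -> : - ((r - s) ^+ 2 / (4 * u)) = - (r ^+ 2 + s ^+ 2) / (4 * u) + r * s / (2 * u).
    by field; rewrite gt_eqF.
  have -> : 1 + r * s / (2 * u) = (2 * u + r * s) / (2 * u) by field; rewrite gt_eqF.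
  rewrite expRD !powR_div ?(ltW rs0) ?(ltW u20) ?addr_ge0 ?(ltW rs0) ?(ltW u20)//.
  have -> : z - 2^-1 = - (2^-1 - z) by ring.
  rewrite !powRN.
  have -> : (2 * u) `^ z = (2 * u) `^ 2^-1 / (2 * u) `^ (2^-1 - z).
    by rewrite -powRN -powRDr//; congr (_ `^ _); ring.
  have uE : 2 * u = (2 * u) `^ 2^-1 * (2 * u) `^ 2^-1.
    by rewrite -powRDr// (_ : 2^-1 + 2^-1 = 1) ?powRr1 ?(ltW u20)//; lra.
  have := powR_gt0 (2^-1 - z) rs0; have := powR_gt0 (2^-1 - z) u20.
  have sq0 := powR_gt0 2^-1 u20.
  have : 0 < (2 * u + r * s) `^ z by rewrite powR_gt0// addr_gt0.
  set A := _ `^ _ in sq0 *.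
  set a := _ `^ _; set b := _ `^ _; set d := _ `^ _ => a0 b0 d0.
  rewrite (_ : d / (2 * u) = d / (A * A)); last by congr (_ / _).
  set e1 := expR _; set e2 := expR _.
  by field; rewrite !gt_eqF.
have /andP[h1 h2] := H _ x0.
rewrite -E /p2 -/P !(mulrCA _ P) !ler_pM2l//.
by rewrite h1 h2.
Qed.

End Bessel.

(** * The 3G inequality for the profile *)

Section ThreeG.
Variable R : realType.
Implicit Types (zeta alpha t r s z : R).

Definition stable_profile zeta alpha t r s : R :=
  t / ((t `^ alpha^-1 + `|r - s|) `^ (1 + alpha) * (t `^ alpha^-1 + r + s) `^ (2 * zeta)).

Lemma stable_profile_gt0 zeta alpha t r s : 0 < t -> 0 < r -> 0 < s ->
  0 < stable_profile zeta alpha t r s.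
Proof.
move=> t0 r0 s0; have T0 : 0 < t `^ alpha^-1 by rewrite powR_gt0.
rewrite divr_gt0// mulr_gt0// powR_gt0//; first by rewrite ltr_wpDr.
by rewrite !addr_gt0.
Qed.

Lemma stable_profileC zeta alpha t r s :
  stable_profile zeta alpha t r s = stable_profile zeta alpha t s r.
Proof. by rewrite /stable_profile distrC addrAC. Qed.

(** The two factors of the denominator are compared separately: the first inequality is raised to
    the power 1 + alpha and the second, which carries the weight, to the power 2 zeta. The
    numerators are compared by t <= t'. *)
Lemma stable_profile_compare zeta alpha (M : R) t t' r s z : 0 <= zeta -> 0 < alpha -> 0 < M ->
  0 < r -> 0 < s -> 0 < z -> 0 < t -> t <= t' ->
  t' `^ alpha^-1 + `|r - s| <= M * (t `^ alpha^-1 + `|r - z|) ->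
  (r + z) * (t' `^ alpha^-1 + r + s) <= M * ((t `^ alpha^-1 + r + z) * (r + s + z)) ->
  ((r + z) / (r + s + z)) `^ (2 * zeta) * stable_profile zeta alpha t r z <=
  M `^ (1 + alpha) * M `^ (2 * zeta) * stable_profile zeta alpha t' r s.
Proof.
move=> zeta0 alpha0 M0 r0 s0 z0 t0 tt' hT hW.
have t'0 : 0 < t' by exact: lt_le_trans tt'.
have T0 : 0 < t `^ alpha^-1 by rewrite powR_gt0.
have T'0 : 0 < t' `^ alpha^-1 by rewrite powR_gt0.
rewrite /stable_profile.
set T := t `^ alpha^-1 in hT hW T0 *; set T' := t' `^ alpha^-1 in hT hW T'0 *.
have A0 : 0 < T + `|r - z| by rewrite ltr_wpDr.
have A'0 : 0 < T' + `|r - s| by rewrite ltr_wpDr.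
have B0 : 0 < T + r + z by rewrite !addr_gt0.
have B'0 : 0 < T' + r + s by rewrite !addr_gt0.
have S0 : 0 < r + s + z by rewrite !addr_gt0.
have rz0 : 0 < r + z by rewrite addr_gt0.
have zeta20 : 0 <= 2 * zeta by rewrite mulr_ge0.
have alpha10 : 0 <= 1 + alpha by lra.
have h1 : (T' + `|r - s|) `^ (1 + alpha) <= M `^ (1 + alpha) * (T + `|r - z|) `^ (1 + alpha).
  by rewrite -powRM ?(ltW M0) ?(ltW A0)//; apply: powR_homo => //; exact: ltW.
have h2 : (r + z) `^ (2 * zeta) * (T' + r + s) `^ (2 * zeta) <=
    M `^ (2 * zeta) * ((T + r + z) `^ (2 * zeta) * (r + s + z) `^ (2 * zeta)).
  rewrite -!powRM ?mulr_ge0 ?(ltW M0) ?(ltW B0) ?(ltW B'0) ?(ltW S0) ?(ltW rz0)//.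
  by apply: powR_homo => //; rewrite mulr_ge0// ltW.
rewrite powR_div ?(ltW rz0) ?(ltW S0)//.
have := powR_gt0 (1 + alpha) A0; have := powR_gt0 (1 + alpha) A'0.
have := powR_gt0 (2 * zeta) B0; have := powR_gt0 (2 * zeta) B'0.
have := powR_gt0 (2 * zeta) S0; have := powR_gt0 (2 * zeta) rz0.
have := powR_gt0 (2 * zeta) M0; have := powR_gt0 (1 + alpha) M0.
move: h1 h2.
set a := (_ `^ _); set m := (_ `^ _); set b := (_ `^ _); set c := (_ `^ _).
set d := (_ `^ _); set m' := (_ `^ _); set e := (_ `^ _); set f := (_ `^ _).
move=> h1 h2 m0 m'0 c0 f0 d0 e0 a0 b0.
rewrite [leLHS](_ : _ = (c * t) / (f * (b * e))); last by field; rewrite !gt_eqF.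
rewrite [leRHS](_ : _ = (m * m' * t') / (a * d)); last by field; rewrite !gt_eqF.
rewrite ler_pdivrMr ?mulr_gt0// mulrAC ler_pdivlMr ?mulr_gt0//.
rewrite [leLHS](_ : _ = t * (a * (c * d))); last by ring.
rewrite [leRHS](_ : _ = t' * ((m * b) * (m' * (e * f)))); last by ring.
by apply: ler_pM; rewrite ?mulr_ge0// ?(ltW t0) ?(ltW a0) ?(ltW c0) ?(ltW d0)//;
   apply: ler_pM => //; rewrite ?mulr_ge0// ?(ltW a0) ?(ltW c0) ?(ltW d0).
Qed.

Lemma powR_add_le_max (p t t' : R) : 0 <= p -> 0 <= t' -> t' <= t ->
  (t + t') `^ p <= 2 `^ p * t `^ p.
Proof.
move=> p0 t'0 tt'; have t0 : 0 <= t by exact: le_trans tt'.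
by rewrite -powRM//; apply: powR_homo => //; lra.
Qed.

(** If T3 <= S, then T3 + q <= 2 S and p is kept. Otherwise p <= S, and T3 + q <= 2 T3 <= 2 K T. *)
Lemma weight_le (K T T3 p q S : R) : 1 <= K -> 0 < T -> 0 < p -> p <= S -> 0 <= q -> q <= S ->
  T3 <= S \/ S <= T3 <= K * T ->
  p * (T3 + q) <= (2 * K + 2) * ((T + p) * S).
Proof.
move=> K1 T0 p0 pS q0 qS H; have S0 : 0 < S by exact: lt_le_trans pS.
have h0 : 0 <= T * S by rewrite mulr_ge0// ltW.
have h1 : 0 <= p * S by rewrite mulr_ge0// ltW.
have h2 : p * S <= K * (p * S) by rewrite ler_peMl.
have h3 : T * S <= K * (T * S) by rewrite ler_peMl.
rewrite [leRHS](_ : _ = 2 * (K * (T * S)) + 2 * (K * (p * S)) + 2 * (T * S) + 2 * (p * S)); last by ring.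
case: H => [T3S|/andP[ST3 T3K]].
  have : p * (T3 + q) <= p * (2 * S) by rewrite ler_pM2l//; lra.
  by rewrite mulrCA; lra.
have T30 : 0 <= T3 by lra.
have : p * (T3 + q) <= S * (2 * (K * T)) by apply: ler_pM; lra.
by rewrite [S * _](_ : _ = 2 * (K * (T * S))); [lra|ring].
Qed.

(** With T3 = (t + t')^(1/alpha), always T3 <= K max(T, T'). When T3 is at most r + s + z, the
    favourable pair is the one with the larger sum of time scale and distance, by the triangle
    inequality. When T3 exceeds r + s + z, it dominates every distance, and the pair with the larger
    time is favourable. *)
Lemma stable_profile_3G zeta alpha : 0 <= zeta -> 0 < alpha ->
  exists2 C : R, 0 < C & forall r s z t t' : R,
    0 < r -> 0 < s -> 0 < z -> 0 < t -> 0 < t' ->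
    ((r + z) / (r + s + z)) `^ (2 * zeta) * stable_profile zeta alpha t r z <=
      C * stable_profile zeta alpha (t + t') r s \/
    ((s + z) / (r + s + z)) `^ (2 * zeta) * stable_profile zeta alpha t' z s <=
      C * stable_profile zeta alpha (t + t') r s.
Proof.
move=> zeta0 alpha0; set K := 2 `^ alpha^-1 : R.
have ia0 : 0 <= alpha^-1 by rewrite invr_ge0 ltW.
have K1 : 1 <= K by rewrite -(powRr0 2); apply: ler_powR => //; rewrite ler1n.
pose M := 2 * K + 2.
have M0 : 0 < M by rewrite /M; lra.
exists (M `^ (1 + alpha) * M `^ (2 * zeta)); first by rewrite mulr_gt0// powR_gt0.
move=> r s z t t' r0 s0 z0 t0 t'0.
have symmetric : ((t + t') `^ alpha^-1 + `|r - s| <= M * (t' `^ alpha^-1 + `|s - z|)) ->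
  (s + z) * ((t + t') `^ alpha^-1 + r + s) <= M * ((t' `^ alpha^-1 + s + z) * (r + s + z)) ->
  ((s + z) / (r + s + z)) `^ (2 * zeta) * stable_profile zeta alpha t' z s <=
      M `^ (1 + alpha) * M `^ (2 * zeta) * stable_profile zeta alpha (t + t') r s.
  move=> h1 h2; rewrite (stable_profileC _ _ t') (stable_profileC _ _ (t + t')).
  rewrite (addrC r s); apply: stable_profile_compare => //; first lra.
    by rewrite distrC.
  by rewrite (addrC s r) [X in _ * X <= _]addrAC.
have h (a b : R) : 0 < a -> 0 < b -> b <= a -> (a + b) `^ alpha^-1 <= K * a `^ alpha^-1.
  by move=> a0 b0 ba; apply: powR_add_le_max => //; exact: ltW.
have tri : `|r - s| <= `|r - z| + `|s - z| by rewrite (distrC s) ler_distD.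
have rs : `|r - s| <= r + s by rewrite ler_norml; apply/andP; split; lra.
have m1 : t `^ alpha^-1 <= (t + t') `^ alpha^-1 by apply: powR_homo => //; lra.
have m2 : t' `^ alpha^-1 <= (t + t') `^ alpha^-1 by apply: powR_homo => //; lra.
have max1 : t' <= t -> (t + t') `^ alpha^-1 <= K * t `^ alpha^-1 by exact: h.
have max2 : t <= t' -> (t + t') `^ alpha^-1 <= K * t' `^ alpha^-1.
  by rewrite addrC; exact: h.
have T0 : 0 < t `^ alpha^-1 by rewrite powR_gt0.
have T'0 : 0 < t' `^ alpha^-1 by rewrite powR_gt0.
have n1 := normr_ge0 (r - z); have n2 := normr_ge0 (s - z).
set T := t `^ alpha^-1 in m1 max1 T0 *; set T' := t' `^ alpha^-1 in symmetric m2 max2 T'0 *.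
set T3 := (t + t') `^ alpha^-1 in symmetric m1 m2 max1 max2 *.
have maxT : T3 <= K * T \/ T3 <= K * T'.
  by case: (leP t' t) => [/max1|/ltW/max2]; [left|right].
have KT : T <= K * T by rewrite ler_peMl// ltW.
have KT' : T' <= K * T' by rewrite ler_peMl// ltW.
have weight1 : T3 <= r + s + z \/ r + s + z <= T3 <= K * T ->
    (r + z) * (T3 + r + s) <= M * ((T + r + z) * (r + s + z)).
  by rewrite -!addrA (addrA r s z) => ?; apply: weight_le => //; lra.
have weight2 : T3 <= r + s + z \/ r + s + z <= T3 <= K * T' ->
    (s + z) * (T3 + r + s) <= M * ((T' + s + z) * (r + s + z)).
  by rewrite -!addrA (addrA r s z) => ?; apply: weight_le => //; lra.
have bound (a b c : R) : 0 <= a -> 0 < b -> T3 <= K * c -> c <= b + a ->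
    `|r - s| <= 2 * (b + a) -> T3 + `|r - s| <= M * (b + a).
  move=> a0 b0 h1 h2 h3; have : K * c <= K * (b + a) by rewrite ler_pM2l//; lra.
  have : 0 <= K * (b + a) by apply: mulr_ge0; lra.
  by rewrite /M mulrDl -mulrA; lra.
case: (leP T3 (r + s + z)) => T3S.
  case: (leP (T' + `|s - z|) (T + `|r - z|)) => cmp.
    left; apply: stable_profile_compare => //; first lra.
      by rewrite -/T -/T3; case: maxT => H; apply: (bound _ _ _ _ _ H); lra.
    by apply: weight1; left.
  right; apply: symmetric; last by apply: weight2; left.
  by case: maxT => H; apply: (bound _ _ _ _ _ H); lra.
case: maxT => maxT.
  left; apply: stable_profile_compare => //; first lra.
    by rewrite -/T -/T3 /M mulrDl -mulrA mulrDr; have := mulr_ge0 (le_trans ler01 K1) n1; lra.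
  by apply: weight1; right; rewrite maxT (ltW T3S).
right; apply: symmetric; last by apply: weight2; right; rewrite maxT (ltW T3S).
by rewrite /M mulrDl -mulrA mulrDr; have := mulr_ge0 (le_trans ler01 K1) n2; lra.
Qed.

End ThreeG.

(** * Integrals against the stable density *)

Section StableDensity.
Variable R : realType.
Local Notation mu := (@lebesgue_measure R).
Local Notation Rpos := (`]0%R, +oo[%classic : set R).
Implicit Types (alpha t lam u : R).

Section FixedDensity.
Variables (alpha : R) (sigma : R -> R -> R).
Hypothesis sigmaP : is_stable_subordinator_density alpha sigma.
Variable t : R.
Hypothesis t0 : 0 < t.

Lemma stable_density_ge0 u : 0 < u -> 0 <= sigma t u.
Proof. by have [+ _ _ _] := sigmaP t0; apply. Qed.

Lemma stable_mean_ge0 (g : R -> R) u : Rpos u ->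
  (0 < u -> 0 <= g u) -> (0 <= (g u * sigma t u)%:E)%E.
Proof.
rewrite /= in_itv/= andbT => u0 /(_ u0) g0.
by rewrite lee_fin mulr_ge0// stable_density_ge0.
Qed.

Lemma measurable_stable_mean (g : R -> R) : measurable_fun setT g ->
  measurable_fun Rpos (fun u => (g u * sigma t u)%:E).
Proof.
move=> mg; apply/measurable_EFinP; apply: measurable_funM.
  exact: measurable_funTS.
by have [_ + _ _] := sigmaP t0.
Qed.

Lemma measurable_expRNM (lam : R) : measurable_fun setT (fun u : R => expR (- (u * lam))).
Proof.
apply: measurableT_comp; first exact: measurable_expR.
by apply: measurableT_comp => //; exact: measurable_funM.
Qed.

Lemma stable_mean_laplace lam : 0 <= lam ->
  (\int[mu]_(u in `]0%R, +oo[) (expR (- (u * lam)) * sigma t u)%:E =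
   (expR (- (t * lam `^ (alpha / 2))))%:E)%E.
Proof. by have [_ _ _] := sigmaP t0; apply. Qed.

Lemma onem_expRN_ge0 (lam : R) u : 0 <= lam -> 0 < u -> 0 <= 1 - expR (- (u * lam)).
Proof. by move=> l0 u0; rewrite subr_ge0 -expR0 ler_expR lerNl oppr0 mulr_ge0// ltW. Qed.

Lemma measurable_onem_expRNM (lam : R) : measurable_fun setT (fun u : R => 1 - expR (- (u * lam))).
Proof. by apply: measurable_funB => //; exact: measurable_expRNM. Qed.

Lemma stable_mean_onem lam : 0 <= lam ->
  (\int[mu]_(u in `]0%R, +oo[) ((1 - expR (- (u * lam))) * sigma t u)%:E =
   (1 - expR (- (t * lam `^ (alpha / 2))))%:E)%E.
Proof.
move=> l0.
have [_ _ m1 _] := sigmaP t0.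
(* The Laplace transform is added back rather than subtracted, so that additivity is needed for
   nonnegative integrands only. *)
have E : (\int[mu]_(u in `]0%R, +oo[) ((1 - expR (- (u * lam))) * sigma t u)%:E +
    (expR (- (t * lam `^ (alpha / 2))))%:E = 1)%E.
  rewrite -(stable_mean_laplace l0) -ge0_integralD//=.
  - by rewrite -m1; apply: eq_integral => u _; rewrite -EFinD; congr EFin; ring.
  - by move=> u u0; apply: (stable_mean_ge0 (g := fun u => 1 - expR (- (u * lam)))) => //; exact: onem_expRN_ge0.
  - exact: measurable_stable_mean (measurable_onem_expRNM lam).
  - by move=> u u0; apply: (stable_mean_ge0 (g := fun u => expR (- (u * lam)))) => // _; exact: expR_ge0.
  - exact: measurable_stable_mean (measurable_expRNM lam).
move: E; set X := (\int[mu]_(u in _) _)%E; case: X => [x| |]//.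
by rewrite -EFinD => -[E]; congr EFin; lra.
Qed.

Lemma stable_mean_onem_le lam : 0 <= lam ->
  (\int[mu]_(u in `]0%R, +oo[) ((1 - expR (- (u * lam))) * sigma t u)%:E <=
   (t * lam `^ (alpha / 2))%:E)%E.
Proof.
move=> l0; rewrite stable_mean_onem// lee_fin.
by have := expR_ge1Dx (- (t * lam `^ (alpha / 2))); lra.
Qed.

End FixedDensity.

Lemma onem_expRN_ge_half (s : R) : 0 <= s -> s <= 1 -> s / 2 <= 1 - expR (- s).
Proof.
move=> s0 s1; have := expR_ge1Dx s => h; have e0 := expR_gt0 s.
suff : expR (- s) <= 1 - s / 2 by lra.
rewrite expRN -[leLHS]mul1r ler_pdivrMr//.
have h2 : 1 <= (1 - s / 2) * (1 + s) by nra.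
by apply: le_trans h2 _; rewrite ler_wpM2l//; lra.
Qed.

(** Below the annulus, u/y = 2a (u/(ay))/2 is at most 2a (1 - e^(-u/(ay))) by [onem_expRN_ge_half].
    Inside, the indicator alone suffices. Above, 2 (1 - e^(-1)) >= 1. *)
Lemma onem_expRN_le_annulus (a b y u : R) : 0 < a -> 0 < b -> 0 < y -> 0 < u ->
  1 - expR (- (u * y^-1)) <= \1_(`[a * y, b * y]%classic) u +
    (2 * a * (1 - expR (- (u * (a * y)^-1))) + 2 * (1 - expR (- (u * (b * y)^-1)))).
Proof.
move=> a0 b0 y0 u0.
have ay0 : 0 < a * y by rewrite mulr_gt0.
have by0 : 0 < b * y by rewrite mulr_gt0.
have iay : 0 <= (a * y)^-1 by rewrite invr_ge0 ltW.
have iby : 0 <= (b * y)^-1 by rewrite invr_ge0 ltW.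
have p1 := onem_expRN_ge0 iay u0; have p2 := onem_expRN_ge0 iby u0.
have a20 : 0 <= 2 * a by rewrite mulr_ge0 ?ler0n// ltW.
have p3 := mulr_ge0 a20 p1.
have e0 := expR_gt0 (- (u * y^-1)).
have i0 : 0 <= \1_(`[a * y, b * y]%classic) u :> R by rewrite indicE ler0n.
case: (ltP u (a * y)) => uay.
  have v1 : u * (a * y)^-1 <= 1 by rewrite ler_pdivrMr// mul1r ltW.
  have v0 : 0 <= u * (a * y)^-1 by rewrite mulr_ge0// ltW.
  have h := ler_wpM2l a20 (onem_expRN_ge_half v0 v1).
  have e1 := expR_ge1Dx (- (u * y^-1)).
  have E : 2 * a * (u * (a * y)^-1 / 2) = u * y^-1 by field; rewrite !gt_eqF.
  rewrite E in h.
  set i := \1_ _ u in i0 *; set A := 2 * a * _ in p3 h *; set B := 1 - expR (- (u * (b * y)^-1)) in p2 *.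
  set v := u * y^-1 in h e1 e0 *; set ev := expR _ in e1 e0 *.
  by clearbody i A B ev v; clear -i0 p2 h e1; lra.
case: (leP u (b * y)) => uby.
  rewrite indicE mem_set/=; last by rewrite in_itv/= uay uby.
  set A := 2 * a * _ in p3 *; set B := 1 - expR (- (u * (b * y)^-1)) in p2 *.
  by clearbody A B; lra.
have v1 : 1 <= u * (b * y)^-1 by rewrite ler_pdivlMr// mul1r ltW.
have h1 := onem_expRN_ge_half ler01 (lexx 1).
have h2 : expR (- (u * (b * y)^-1)) <= expR (- 1) by rewrite ler_expR lerN2.
set i := \1_ _ u in i0 *; set A := 2 * a * _ in p3 *.
set e2 := expR _ in h2 *; set e3 := expR _ in e0 *.
by clearbody i A e2 e3; lra.
Qed.

Lemma ler_mul_sum3 (x i A B C D c : R) : 0 <= c -> x <= i + (A * B + C * D) ->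
  x * c <= i * c + (A * (B * c) + C * (D * c)).
Proof. by move=> c0 /(ler_wpM2r c0); rewrite !mulrDl -!mulrA. Qed.

Lemma stable_annulus_mass alpha : 0 < alpha -> alpha < 2 ->
  exists a b : R, [/\ 0 < a, 0 < b &
    forall sigma, is_stable_subordinator_density alpha sigma ->
    forall t y : R, 0 < t -> 0 < y -> t * (y^-1) `^ (alpha / 2) <= 1 ->
    ((t * (y^-1) `^ (alpha / 2) / 4)%:E <=
      \int[mu]_(u in `]0%R, +oo[) (\1_(`[a * y, b * y]%classic) u * sigma t u)%:E)%E].
Proof.
move=> alpha0 alpha2; set beta := alpha / 2.
have beta0 : 0 < beta by rewrite /beta; lra.
have beta1 : 0 < 1 - beta by rewrite /beta; lra.
(* With s = t y^(-beta), the two error terms have means at most 2 a^(1-beta) s and 2 b^(-beta) s;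
   these choices make both equal to s/8. As the left side has mean at least s/2, mass s/4 remains
   for the annulus. The exponent of [a] uses beta < 1. *)
pose a : R := 16^-1 `^ (1 - beta)^-1; pose b : R := 16 `^ beta^-1.
have a0 : 0 < a by rewrite powR_gt0// invr_gt0.
have b0 : 0 < b by rewrite powR_gt0.
have aE : a * (a^-1) `^ beta = 16^-1.
  rewrite powRV ?(ltW a0)// -{1}(powRr1 (ltW a0)) -powRN -powRDr// /a -powRrM mulVf ?gt_eqF//.
  by rewrite powRr1// invr_ge0.
have bE : (b^-1) `^ beta = 16^-1.
  by rewrite powRV ?(ltW b0)// /b -powRrM mulVf ?gt_eqF// powRr1.
exists a, b; split => // sigma sigmaP t y t0 y0 s1.
clearbody a b.
set s := t * _ in s1 *.
have s0 : 0 <= s by rewrite mulr_ge0 ?powR_ge0// ltW.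
pose I := (\int[mu]_(u in `]0%R, +oo[) (\1_(`[a * y, b * y]%classic) u * sigma t u)%:E)%E.
have ay0 : 0 < a * y by rewrite mulr_gt0.
have by0 : 0 < b * y by rewrite mulr_gt0.
pose g lam (u : R) := (1 - expR (- (u * lam))) * sigma t u.
have g0 lam u : 0 <= lam -> Rpos u -> (0 <= (g lam u)%:E)%E.
  move=> l0 u0; apply: (stable_mean_ge0 sigmaP t0 (g := fun u => 1 - expR (- (u * lam)))) => //.
  exact: onem_expRN_ge0.
have mg lam : measurable_fun Rpos (fun u => (g lam u)%:E).
  exact: (measurable_stable_mean sigmaP t0 (measurable_onem_expRNM lam)).
have mI : measurable_fun Rpos (fun u => (\1_(`[a * y, b * y]%classic) u * sigma t u)%:E).
  by apply: (measurable_stable_mean sigmaP t0); exact: measurable_indic.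
have I0 u : Rpos u -> (0 <= (\1_(`[a * y, b * y]%classic) u * sigma t u)%:E)%E.
  by move=> u0; apply: (stable_mean_ge0 sigmaP t0 (g := \1_(`[a * y, b * y]%classic))) => // _; rewrite indicE ler0n.
have iy : 0 <= y^-1 by rewrite invr_ge0 ltW.
have iay : 0 <= (a * y)^-1 by rewrite invr_ge0 ltW.
have iby : 0 <= (b * y)^-1 by rewrite invr_ge0 ltW.
have key : ((1 - expR (- s))%:E <= I + ((2 * a * (t * (a * y)^-1 `^ beta))%:E + (2 * (t * (b * y)^-1 `^ beta))%:E))%E.
  rewrite -(stable_mean_onem sigmaP t0 iy).
  apply: (@le_trans _ _ (\int[mu]_(u in `]0%R, +oo[) ((\1_(`[a * y, b * y]%classic) u * sigma t u)%:E +
     ((2 * a)%:E * (g (a * y)^-1 u)%:E + 2%:E * (g (b * y)^-1 u)%:E)))%E).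
    apply: ge0_le_integral_nonmeas => u u0; first exact: g0.
    rewrite -!EFinM -!EFinD lee_fin /g.
    move: u0; rewrite /= in_itv/= andbT => u0.
    exact: (ler_mul_sum3 (stable_density_ge0 sigmaP t0 u0) (onem_expRN_le_annulus a0 b0 y0 u0)).
  have a20 : 0 <= 2 * a by rewrite mulr_ge0// ltW.
  have q1 u : Rpos u -> (0 <= (2 * a)%:E * (g (a * y)^-1 u)%:E)%E.
    by move=> u0; apply: mule_ge0; [rewrite lee_fin|exact: g0].
  have q2 u : Rpos u -> (0 <= 2%:E * (g (b * y)^-1 u)%:E)%E.
    by move=> u0; apply: mule_ge0; [rewrite lee_fin|exact: g0].
  have mq c lam : measurable_fun Rpos (fun u => c%:E * (g lam u)%:E)%E.
    by apply: emeasurable_funM => //; exact: mg.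
  rewrite ge0_integralD//=; last 2 first.
  - by move=> u u0; apply: adde_ge0; [exact: q1|exact: q2].
  - by apply: emeasurable_funD; exact: mq.
  rewrite leeD2l// ge0_integralD//=; last 2 first.
  - exact: mq.
  - exact: mq.
  rewrite !ge0_integralZl_EFin//=; [|by move=> u u0; exact: g0|exact: mg|by move=> u u0; exact: g0|exact: mg].
  by apply: leeD; rewrite [leRHS]EFinM; apply: lee_wpmul2l; rewrite ?lee_fin//; exact: stable_mean_onem_le.
have := onem_expRN_ge_half s0 s1.
rewrite -lee_fin => /le_trans/(_ key).
have -> : 2 * a * (t * (a * y)^-1 `^ beta) = s / 8.
  rewrite invfM powRM ?invr_ge0 ?(ltW a0) ?(ltW y0)//.
  rewrite (_ : _ * _ = 2 * (a * (a^-1) `^ beta) * s); last by rewrite /s; ring.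
  by rewrite aE; lra.
have -> : 2 * (t * (b * y)^-1 `^ beta) = s / 8.
  rewrite invfM powRM ?invr_ge0 ?(ltW b0) ?(ltW y0)// bE.
  by rewrite /s; field.
rewrite -EFinD -leeBlDr// -EFinB.
by apply: le_trans; rewrite lee_fin; lra.
Qed.

Lemma sum_powR_expRN_bounded (a beta : R) : 0 <= a -> 0 < beta ->
  exists2 B : R, 0 <= B & forall n : nat,
    \sum_(0 <= k < n) (k.+1%:R `^ a * expR (- (k.+1%:R `^ beta))) <= B.
Proof.
(* This exponent gives (m^beta)^p = m^(a+2), so each term is at most C / m^2 <= 2 C (1/m - 1/(m+1)),
   and the sum telescopes. *)
move=> a0 beta0; pose p := (a + 2) / beta; pose C : R := (p + 1) `^ p.
have p0 : 0 <= p by rewrite divr_ge0 ?(ltW beta0)//; lra.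
have C0 : 0 <= C by exact: powR_ge0.
exists (2 * C) => [|n]; first by rewrite mulr_ge0.
suff : \sum_(0 <= k < n) (k.+1%:R `^ a * expR (- (k.+1%:R `^ beta))) <= 2 * C * (1 - n.+1%:R^-1).
  move=> h; apply: le_trans h _; rewrite ler_piMr ?mulr_ge0//.

elim: n => [|n IH]; first by rewrite big_geq// invr1 subrr mulr0.
rewrite big_nat_recr//=; apply: le_trans (lerD IH (_ : _ <= 2 * C * (n.+1%:R^-1 - n.+2%:R^-1))) _; last first.
  by rewrite -mulrDr addrA subrK.
set m : R := n.+1%:R; have m0 : 0 < m by rewrite /m.
have m1 : 1 <= m by rewrite ler1n.
have -> : n.+2%:R = m + 1 :> R by rewrite -natr1.
have := powR_le_expR p0 (powR_gt0 beta m0).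
rewrite -powRrM /p (mulrC beta) divfK ?gt_eqF// powRDr// [m `^ 2]powR_mulrn ?(ltW m0)// -/p -/C => h.
rewrite expRN ler_pdivrMr ?expR_gt0//.
have -> : 2 * C * (m^-1 - (m + 1)^-1) = C * (2 / (m * (m + 1))) by field; rewrite !gt_eqF//; lra.
apply: (@le_trans _ _ (C * expR (m `^ beta) / m ^+ 2)).
  by rewrite ler_pdivlMr// exprn_gt0.
rewrite mulrAC ler_wpM2r ?expR_ge0// ler_wpM2l//.
rewrite ler_pdivlMr; last by rewrite mulr_gt0//; lra.
rewrite mulrC ler_pdivrMr ?exprn_gt0// expr2; nra.
Qed.

(** For v >= 1 the summand 1 suffices. For v < 1 a single term does, the one with k + 1 the integer
    part of 1/v: v (k + 1) <= 1 makes e e^(-v(k+1)) at least 1, and 1/v < k + 2 <= 2 (k + 1). *)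
Lemma inv_powR_le_series (a v : R) : 0 <= a -> 0 < v ->
  (((v `^ a)^-1)%:E <= 1 + \sum_(0 <= k <oo)
    (2 `^ a * expR 1 * (k.+1%:R `^ a * expR (- (v * k.+1%:R))))%:E)%E.
Proof.
move=> a0 v0.
have term0 (k : nat) : (0 <= (2 `^ a * expR 1 * (k.+1%:R `^ a * expR (- (v * k.+1%:R))))%:E)%E.
  by rewrite lee_fin !mulr_ge0 ?powR_ge0 ?expR_ge0.
case: (leP 1 v) => v1.
  apply: (@le_trans _ _ 1%E); last by rewrite leeDl// nneseries_ge0.
  by rewrite lee_fin invf_le1 ?powR_gt0// -[leLHS](powRr0 v) ler_powR.
have iv : 1 < v^-1 by rewrite invf_gt1.
have /andP[k1 k2] := @truncn_itv R v^-1 (ltW (lt_trans ltr01 iv)).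
case E : (Num.truncn v^-1) k1 k2 => [|k] k1 k2; first by have := lt_trans iv k2; rewrite ltxx.
apply: (@le_trans _ _ (2 `^ a * expR 1 * (k.+1%:R `^ a * expR (- (v * k.+1%:R))))%:E).
  rewrite lee_fin [leRHS](_ : _ = (2 `^ a * k.+1%:R `^ a) * (expR 1 * expR (- (v * k.+1%:R)))); last by ring.
  rewrite -[leLHS]mulr1; apply: ler_pM => //; first by rewrite invr_ge0 powR_ge0.
    rewrite -powRV ?(ltW v0)// -powRM//; apply: powR_homo; rewrite ?invr_ge0 ?(ltW v0)//.
    have l1 : 1 <= k.+1%:R :> R by rewrite ler1n.
    by move: k2; rewrite -[k.+2%:R]natr1; lra.
  rewrite -expRD -[leLHS]expR0 ler_expR subr_ge0.
  by rewrite -[leRHS](mulfV (lt0r_neq0 v0)) ler_pM2l.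
pose F (i : nat) : \bar R := (2 `^ a * expR 1 * (i.+1%:R `^ a * expR (- (v * i.+1%:R))))%:E.
apply: (@le_trans _ _ (\sum_(0 <= i <oo) F i)%E); last by rewrite leeDr.
apply: (@le_trans _ _ (\sum_(0 <= i < k.+1) F i)%E); last first.
  by apply: (@nneseries_lim_ge _ _ xpredT 0 k.+1) => n _ _; exact: term0.
rewrite big_nat_recr//= -/(F k); apply: lee_paddl; last exact: lexx.
by apply: sume_ge0 => i _; exact: term0.
Qed.

Lemma stable_negative_moment alpha (a : R) : 0 < alpha -> 0 <= a ->
  exists2 M : R, 0 < M & forall sigma, is_stable_subordinator_density alpha sigma ->
    forall t, 0 < t ->
    (\int[mu]_(u in `]0%R, +oo[) ((u `^ a)^-1 * sigma t u)%:E <=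
      (M / (t `^ alpha^-1) `^ (2 * a))%:E)%E.
Proof.
move=> alpha0 a0; pose beta := alpha / 2.
have beta0 : 0 < beta by rewrite divr_gt0.
have [B B0 HB] := sum_powR_expRN_bounded a0 beta0.
pose K : R := 2 `^ a * expR 1.
have K0 : 0 <= K by rewrite mulr_ge0 ?powR_ge0 ?expR_ge0.
exists (1 + K * B); first by rewrite ltr_pwDl// mulr_ge0.
move=> sigma sigmaP t t0; set T := t `^ alpha^-1.
have T0 : 0 < T by rewrite powR_gt0.
have Ta : T `^ alpha = t by rewrite /T -powRrM mulVf ?gt_eqF// powRr1// ltW.
set D := T `^ (2 * a); have D0 : 0 < D by rewrite powR_gt0.
(* The series bound is applied at v = u / T^2. At these rates the Laplace exponent t lam^(alpha/2)
   is (k + 1)^beta, free of t, which makes the moment constant uniform in t. *)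
pose lam (k : nat) : R := k.+1%:R / T ^+ 2.
have lam0 k : 0 <= lam k by rewrite divr_ge0// sqr_ge0.
have lamE k : t * lam k `^ (alpha / 2) = k.+1%:R `^ beta.
  rewrite /lam powR_div ?sqr_ge0// powR_sqr ?(ltW T0)//.
  rewrite (_ : 2 * (alpha / 2) = alpha); last by field.
  by rewrite Ta mulrC divfK ?gt_eqF.
pose f (k : nat) (u : R) := ((K * k.+1%:R `^ a)%:E * (expR (- (u * lam k)) * sigma t u)%:E)%E.
have c0 k : 0 <= K * k.+1%:R `^ a by rewrite mulr_ge0 ?powR_ge0.
have f0 k u : Rpos u -> (0 <= f k u)%E.
  move=> u0; apply: mule_ge0; first by rewrite lee_fin.
  by apply: (stable_mean_ge0 sigmaP t0 (g := fun u => expR (- (u * lam k)))) => // _; exact: expR_ge0.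
have mf0 k := measurable_stable_mean sigmaP t0 (measurable_expRNM (lam k)).
have mf k : measurable_fun Rpos (f k) by apply: emeasurable_funM => //; exact: mf0.
have [s0 ms m1 _] := sigmaP t t0.
have s0' u : Rpos u -> (0 <= (sigma t u)%:E)%E.
  by rewrite /= in_itv/= andbT => u0; rewrite lee_fin s0.
have sf0 u : Rpos u -> (0 <= \sum_(0 <= k <oo) f k u)%E.
  by move=> u0; apply: nneseries_ge0 => k _ _; exact: f0.
have msf : measurable_fun Rpos (fun u => \sum_(0 <= k <oo) f k u)%E.
  by apply: ge0_emeasurable_sum => // k u u0 _; exact: f0.
have iD0 : 0 <= D^-1 by rewrite invr_ge0 ltW.
apply: (@le_trans _ _ (\int[mu]_(u in `]0%R, +oo[)
    ((D^-1)%:E * ((sigma t u)%:E + \sum_(0 <= k <oo) f k u)))%E).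
  apply: ge0_le_integral_nonmeas => u u0.
    by apply: (stable_mean_ge0 sigmaP t0 (g := fun u => (u `^ a)^-1)) => // _; rewrite invr_ge0 powR_ge0.
  have s0u := s0' u u0; move: u0; rewrite /= in_itv/= andbT => u0.
  have v0 : 0 < u / T ^+ 2 by rewrite divr_gt0// exprn_gt0.
  have -> : (u `^ a)^-1 * sigma t u = D^-1 * (sigma t u * ((u / T ^+ 2) `^ a)^-1).
    rewrite powR_div ?(ltW u0) ?sqr_ge0// powR_sqr ?(ltW T0)// -/D.
    by field; rewrite !gt_eqF// powR_gt0.
  rewrite EFinM lee_wpmul2l ?lee_fin// EFinM.
  apply: le_trans (lee_wpmul2l s0u (inv_powR_le_series a0 v0)) _.
  rewrite ge0_muleDr//; last by apply: nneseries_ge0 => k _ _; rewrite lee_fin !mulr_ge0 ?powR_ge0 ?expR_ge0.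
  rewrite mule1 leeD2l// -nneseriesZl; last by move=> k _; rewrite lee_fin !mulr_ge0 ?powR_ge0 ?expR_ge0.
  rewrite le_eqVlt; apply/orP; left; apply/eqP; apply: eq_eseriesr => k _.
  rewrite /f -!EFinM -/K; congr EFin.
  have -> : u / T ^+ 2 * k.+1%:R = u * lam k by rewrite /lam; ring.
  by ring.
rewrite ge0_integralZl_EFin//=; last 2 first.
- by move=> u u0; apply: adde_ge0; [exact: s0'|exact: sf0].
- by apply: emeasurable_funD => //; apply/measurable_EFinP.
rewrite mulrC EFinM lee_wpmul2l ?lee_fin//.
rewrite ge0_integralD//=; last by apply/measurable_EFinP.
rewrite m1 EFinD leeD2l// integral_nneseries//.
have E k : (\int[mu]_(u in `]0%R, +oo[) f k u = (K * (k.+1%:R `^ a * expR (- (k.+1%:R `^ beta))))%:E)%E.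
  rewrite /f ge0_integralZl_EFin//=; [|move=> u u0|exact: mf0]; last first.
    by apply: (stable_mean_ge0 sigmaP t0 (g := fun u => expR (- (u * lam k)))) => // _; exact: expR_ge0.
  by rewrite (stable_mean_laplace sigmaP t0)// -EFinM lamE mulrA.
under eq_eseriesr do rewrite E.
apply: lime_le.
  by apply: is_cvg_nneseries => k _ _; rewrite lee_fin !mulr_ge0 ?powR_ge0 ?expR_ge0.
apply: nearW => n; rewrite sumEFin lee_fin -mulr_sumr ler_wpM2l//.
Qed.

(** * Pointwise upper bounds for the Gaussian profile *)

Lemma heat_profile_le_power (z u r s : R) : 0 <= z -> 0 < u -> 0 < r -> 0 < s ->
  heat_profile z u r s <= (u `^ (2^-1 + z))^-1.
Proof.
move=> z0 u0 r0 s0; have rs0 : 0 < r * s by rewrite mulr_gt0.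
have h : 0 < (2 * u) `^ 2^-1 * (2 * u + r * s) `^ z.
  by rewrite mulr_gt0 ?powR_gt0 ?addr_gt0 ?mulr_gt0.
rewrite /heat_profile ler_pdivrMr// [leRHS]mulrC.
apply: (@le_trans _ _ 1).
  by rewrite -expR0 ler_expR oppr_le0 divr_ge0 ?sqr_ge0// mulr_ge0// ltW.
rewrite ler_pdivlMr ?powR_gt0// mul1r powRDr//.
by apply: ler_pM; rewrite ?powR_ge0//; apply: powR_homo; rewrite ?invr_ge0 ?(ltW u0)//; lra.
Qed.

(** Half of the Gaussian exponent is spent on replacing (2u + rs)^(-z) by (r + s)^(-2z). With x =
    (r-s)^2, this follows from (r+s)^2 u <= 4 (u + x)(2u + rs) and from (u + x)^z e^(-x/(8u)) <=
    const u^z. *)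
Lemma heat_profile_le_gauss (z : R) : 0 <= z ->
  exists2 C : R, 0 < C & forall u r s : R, 0 < u -> 0 < r -> 0 < s ->
    heat_profile z u r s <=
    C / (r + s) `^ (2 * z) * (expR (- ((r - s) ^+ 2 / (8 * u))) / u `^ 2^-1).
Proof.
move=> z0; pose C : R := 4 `^ z * (8 `^ z * ((z + 1) `^ z * expR 1)).
exists C; first by rewrite !mulr_gt0 ?powR_gt0 ?expR_gt0//; lra.
move=> u r s u0 r0 s0; have rs0 : 0 < r * s by rewrite mulr_gt0.
have x0 := sqr_ge0 (r - s).
set x := (r - s) ^+ 2 in x0 *.
have q0 : 0 <= x / (8 * u) by rewrite divr_ge0// mulr_ge0// ltW.
set q := x / (8 * u) in q0 *.
have h1 : (u + x) `^ z * expR (- q) <= 8 `^ z * ((z + 1) `^ z * expR 1) * u `^ z.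
  rewrite expRN ler_pdivrMr ?expR_gt0//.
  have -> : 8 `^ z * ((z + 1) `^ z * expR 1) * u `^ z * expR q =
      (8 * u) `^ z * ((z + 1) `^ z * expR (1 + q)).
    by rewrite powRM ?(ltW u0)// expRD; ring.
  have q1 : 0 < 1 + q by lra.
  apply: (@le_trans _ _ ((8 * u) `^ z * (1 + q) `^ z)); last first.
    by rewrite ler_wpM2l ?powR_ge0// powR_le_expR.
  rewrite -powRM ?mulr_ge0 ?(ltW u0) ?(ltW q1)//; apply: powR_homo => //; first by rewrite addr_ge0// ltW.
  rewrite mulrDr mulr1 /q [8 * u * (x / _)]mulrC divfK; first lra.
  by rewrite gt_eqF// mulr_gt0// ltr0n.
have h2 : (r + s) `^ (2 * z) * u `^ z <= 4 `^ z * (u + x) `^ z * (2 * u + r * s) `^ z.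
  rewrite -powR_sqr ?addr_ge0 ?(ltW r0) ?(ltW s0)//.
  have ux0 : 0 <= u + x by rewrite addr_ge0// ltW.
  have urs0 : 0 <= 2 * u + r * s by rewrite addr_ge0 ?mulr_ge0// ltW.
  rewrite -!powRM ?sqr_ge0 ?(ltW u0) ?mulr_ge0//; apply: powR_homo => //.
    by rewrite mulr_ge0 ?sqr_ge0// ltW.
  have -> : (r + s) ^+ 2 = x + 4 * (r * s) by rewrite /x; ring.
  have xu : 0 <= x * u by rewrite mulr_ge0// ltW.
  have xrs : 0 <= x * (r * s) by rewrite mulr_ge0// ltW.
  have uu : 0 <= u * u by rewrite mulr_ge0// ltW.
  by lra.
have B0 : 0 < (r + s) `^ (2 * z) by rewrite powR_gt0// addr_gt0.
have U0 : 0 < u `^ z by rewrite powR_gt0.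
have V0 : 0 < (2 * u + r * s) `^ z by rewrite powR_gt0// addr_gt0// mulr_gt0.
have W0 : 0 < u `^ 2^-1 by rewrite powR_gt0.
have uu : u `^ 2^-1 <= (2 * u) `^ 2^-1 by apply: powR_homo; rewrite ?invr_ge0 ?(ltW u0)//; lra.
have E0 := expR_gt0 (- q).
have key : expR (- q) * (r + s) `^ (2 * z) <= C * (2 * u + r * s) `^ z.
  rewrite -(ler_pM2r U0) -mulrA.
  apply: le_trans (ler_wpM2l (ltW E0) h2) _.
  have := ler_wpM2r (ltW V0) (ler_wpM2l (powR_ge0 4 z) h1).
  move=> h; apply: le_trans (le_trans _ h) _; rewrite le_eqVlt; apply/orP; left; apply/eqP.
    by ring.
  by rewrite /C; ring.
rewrite /heat_profile -/x.
have -> : - (x / (4 * u)) = - q + - q by rewrite /q; field; rewrite gt_eqF.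
rewrite expRD invfM.
apply: (@le_trans _ _ (expR (- q) * expR (- q) * ((u `^ 2^-1)^-1 * ((2 * u + r * s) `^ z)^-1))).
  rewrite ler_wpM2l ?mulr_ge0 ?(ltW E0)// ler_wpM2r ?invr_ge0 ?(ltW V0)//.
  by rewrite lef_pV2 ?posrE//; exact: lt_le_trans uu.
rewrite [leLHS](_ : _ = expR (- q) / (2 * u + r * s) `^ z * (expR (- q) / u `^ 2^-1)); last first.
  by field; rewrite !gt_eqF.
rewrite ler_wpM2r ?divr_ge0 ?(ltW E0) ?(ltW W0)//.
by rewrite ler_pdivrMr// mulrAC ler_pdivlMr.
Qed.

(** The right side is chosen because its mean under the stable density is controlled by
    [stable_mean_onem_le], giving the decay t / x^(1+alpha). With g = x^2/u, it suffices that sqrt g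
    <= 1 + g and (1 + g)^2 <= 256 e^(g/8), the latter being the square of 1 + g <= 16 e^(g/16). *)
Lemma gauss_le_onem_expRN (x u : R) : 0 < x -> 0 < u ->
  expR (- (x ^+ 2 / (8 * u))) / u `^ 2^-1 <= 256 / x * (1 - expR (- (u * (x ^+ 2)^-1))).
Proof.
move=> x0 u0; set h := u `^ 2^-1; have h0 : 0 < h by rewrite powR_gt0.
have uE : u = h * h by rewrite -powRDr// (_ : 2^-1 + 2^-1 = 1) ?powRr1 ?(ltW u0)//; lra.
set q := u * (x ^+ 2)^-1.
have q0 : 0 < q by rewrite mulr_gt0// invr_gt0 exprn_gt0.
have e1 : q / (1 + q) <= 1 - expR (- q).
  have -> : q / (1 + q) = 1 - (1 + q)^-1 by field; rewrite gt_eqF//; lra.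
  by rewrite lerD2l lerN2 expRN lef_pV2 ?posrE ?expR_gt0//; [exact: expR_ge1Dx|lra].
apply: (@le_trans _ _ (256 / x * (q / (1 + q)))); last first.
  by rewrite ler_wpM2l// divr_ge0 ?ler0n// ltW.
pose g := x ^+ 2 / u; have g0 : 0 < g by rewrite divr_gt0// exprn_gt0.
have gE : g = (x / h) ^+ 2 by rewrite /g uE expr2 expr2; field; rewrite gt_eqF.
have e2 : (1 + g) * (1 + g) <= 256 * expR (g / 8).
  have e3 : 1 + g <= 16 * expR (g / 16) by have := expR_ge1Dx (g / 16); lra.
  have g1 : 0 <= 1 + g by lra.
  have := ler_pM g1 g1 e3 e3.
  rewrite (_ : 16 * _ * _ = 256 * expR (g / 8))//.
  have -> : g / 8 = g / 16 + g / 16 by field.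
  by rewrite expRD; ring.
have -> : x ^+ 2 / (8 * u) = g / 8 by rewrite /g; field; rewrite gt_eqF.
rewrite expRN.
have e4 : x / h <= 1 + g by rewrite gE expr2; have := sqr_ge0 (x / h - 1); rewrite expr2; nra.
have -> : 256 / x * (q / (1 + q)) = 256 / (x * (1 + g)).
  by rewrite /q /g; field; rewrite !gt_eqF//; rewrite ?addr_gt0 ?exprn_gt0.
rewrite -invfM -[leLHS]mul1r ler_pdivrMr ?mulr_gt0 ?expR_gt0//.
rewrite mulrAC ler_pdivlMr; last by rewrite mulr_gt0//; lra.
rewrite mul1r.
have e5 : x <= (1 + g) * h by rewrite -ler_pdivrMr.
apply: (@le_trans _ _ ((1 + g) * (1 + g) * h)).
  rewrite mulrC -mulrA ler_wpM2l//; lra.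
by rewrite mulrA ler_pM2r.
Qed.

End StableDensity.

(** * Two-sided bounds for the stable kernel *)

Section StableKernel.
Variable R : realType.
Local Notation mu := (@lebesgue_measure R).
Local Notation Rpos := (`]0%R, +oo[%classic : set R).
Implicit Types (alpha zeta t r s : R).

Lemma heat_profile_ge0 zeta (u r s : R) : 0 <= heat_profile zeta u r s.
Proof. by rewrite divr_ge0 ?expR_ge0// mulr_ge0 ?powR_ge0. Qed.

Lemma p2_ge0 zeta (u r s : R) : 0 <= zeta -> 0 < u -> 0 < r -> 0 < s -> 0 <= p2 zeta u r s.
Proof.
move=> z0 u0 r0 s0; have [c [C [c0 _ H]]] := p2_bounds z0.
have /andP[h _] := H u r s u0 r0 s0.
by apply: le_trans h; rewrite mulr_ge0 ?heat_profile_ge0// ltW.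
Qed.

Lemma palpha_le alpha zeta sigma t r s (K v : R) (g : R -> R) :
  is_stable_subordinator_density alpha sigma ->
  0 <= zeta -> 0 < t -> 0 < r -> 0 < s -> 0 <= K ->
  measurable_fun setT g -> (forall u, 0 < u -> 0 <= g u) ->
  (forall u, 0 < u -> p2 zeta u r s <= K * g u) ->
  (\int[mu]_(u in `]0%R, +oo[) (g u * sigma t u)%:E <= v%:E)%E ->
  (palpha sigma zeta t r s <= (K * v)%:E)%E.
Proof.
move=> sigmaP z0 t0 r0 s0 K0 mg g0 pg gv.
apply: (@le_trans _ _ (\int[mu]_(u in `]0%R, +oo[) (K%:E * (g u * sigma t u)%:E))%E).
  apply: ge0_le_integral_nonmeas => u u0.
    by apply: (stable_mean_ge0 sigmaP t0 (g := fun u => p2 zeta u r s)) => // ?; exact: p2_ge0.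
  move: u0; rewrite /= in_itv/= andbT => u0.
  rewrite -EFinM lee_fin mulrA ler_wpM2r//; last exact: pg.
  exact: (stable_density_ge0 sigmaP t0 u0).
rewrite ge0_integralZl_EFin//=.
- by rewrite EFinM; apply: lee_wpmul2l => //; rewrite lee_fin.
- by move=> u u0; apply: (stable_mean_ge0 sigmaP t0 (g := g)) => //; exact: g0.
- exact: (measurable_stable_mean sigmaP t0 mg).
Qed.

Lemma palpha_ge alpha zeta sigma t r s (K v : R) (A : set R) :
  is_stable_subordinator_density alpha sigma ->
  0 <= zeta -> 0 < t -> 0 < r -> 0 < s -> 0 <= K -> measurable A ->
  (forall u, 0 < u -> A u -> K <= p2 zeta u r s) ->
  (v%:E <= \int[mu]_(u in `]0%R, +oo[) (\1_A u * sigma t u)%:E)%E ->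
  ((K * v)%:E <= palpha sigma zeta t r s)%E.
Proof.
move=> sigmaP z0 t0 r0 s0 K0 mA pK gv.
have i0 u : Rpos u -> (0 <= (\1_A u * sigma t u)%:E)%E.
  by move=> u0; apply: (stable_mean_ge0 sigmaP t0 (g := \1_A)) => // _; rewrite indicE ler0n.
apply: (@le_trans _ _ (\int[mu]_(u in `]0%R, +oo[) (K%:E * (\1_A u * sigma t u)%:E))%E).
  rewrite ge0_integralZl_EFin//=.
  - by rewrite EFinM; apply: lee_wpmul2l => //; rewrite lee_fin.
  - by apply: (measurable_stable_mean sigmaP t0); exact: measurable_indic.
apply: ge0_le_integral_nonmeas => u u0.
  by apply: mule_ge0; [rewrite lee_fin|exact: i0].
move: u0; rewrite /= in_itv/= andbT => u0.
rewrite -EFinM lee_fin mulrA ler_wpM2r ?(stable_density_ge0 sigmaP t0 u0)//.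
rewrite indicE; case: (boolP (u \in A)) => uA.
  by rewrite mulr1; apply: pK => //; exact: set_mem.
by rewrite mulr0; exact: p2_ge0.
Qed.

(** Lets each regime of the upper bound replace T + |r-s| and T + r + s by dominant terms [X] and
    [Y], at the price of a factor 2 in each base. *)
Lemma stable_profile_ge alpha zeta t r s (X Y : R) : 0 < alpha -> 0 <= zeta ->
  0 < t -> 0 < r -> 0 < s -> 0 < X -> 0 < Y ->
  t `^ alpha^-1 + `|r - s| <= 2 * X -> t `^ alpha^-1 + r + s <= 2 * Y ->
  t / (X `^ (1 + alpha) * Y `^ (2 * zeta)) <=
  2 `^ (1 + alpha) * 2 `^ (2 * zeta) * stable_profile zeta alpha t r s.
Proof.
move=> alpha0 z0 t0 r0 s0 X0 Y0; rewrite /stable_profile.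
have T0 : 0 < t `^ alpha^-1 by rewrite powR_gt0.
set T := t `^ _ in T0 *.
have A0 : 0 < T + `|r - s| by rewrite ltr_wpDr.
have B0 : 0 < T + r + s by rewrite !addr_gt0.
have a0 : 0 <= 1 + alpha by lra.
have z20 : 0 <= 2 * zeta by rewrite mulr_ge0.
move=> /(powR_homo a0 (ltW A0)) + /(powR_homo z20 (ltW B0)).
rewrite powRM ?(ltW X0)// powRM ?(ltW Y0)//.
have := powR_gt0 (1 + alpha) A0; have := powR_gt0 (2 * zeta) B0.
have := powR_gt0 (1 + alpha) X0; have := powR_gt0 (2 * zeta) Y0.
set y := Y `^ _; set x := X `^ _; set b := (T + r + s) `^ _; set a := (T + _) `^ _.
set e := 2 `^ _; set f := 2 `^ _ => y0 x0 b0 a0' h1 h2.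
rewrite mulrA ler_pdivrMr ?mulr_gt0// mulrAC ler_pdivlMr ?mulr_gt0//.
rewrite [leRHS](_ : _ = t * ((e * x) * (f * y))); last by ring.
by rewrite ler_pM2l// ler_pM// ltW.
Qed.

Lemma palpha_upper alpha zeta : 0 <= zeta -> 0 < alpha ->
  exists2 C : R, 0 < C & forall sigma, is_stable_subordinator_density alpha sigma ->
  forall t r s, 0 < t -> 0 < r -> 0 < s ->
  (palpha sigma zeta t r s <= (C * stable_profile zeta alpha t r s)%:E)%E.
Proof.
move=> z0 alpha0.
have [c0 [C0 [_ C00 Hp]]] := p2_bounds z0.
have [C1 C10 HG] := heat_profile_le_gauss z0.
have half0 : 0 <= 2^-1 :> R by rewrite invr_ge0.
have [M1 M10 HM1] := stable_negative_moment alpha0 half0.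
have [M2 M20 HM2] := stable_negative_moment alpha0 (addr_ge0 half0 z0).
have [G G0 HE] : exists2 G : R, 0 < G & forall x u : R, 0 < x -> 0 < u ->
    expR (- (x ^+ 2 / (8 * u))) / u `^ 2^-1 <= G / x * (1 - expR (- (u * (x ^+ 2)^-1))).
  by exists 256; [rewrite ltr0n|exact: gauss_le_onem_expRN].
(* One constant for the three regimes: the tail bound, the moment of order 1/2 and the moment of
   order 1/2 + zeta. *)
pose S : R := G * C1 + C1 * M1 + M2.
have k10 : 0 < G * C1 by rewrite mulr_gt0.
have k20 : 0 < C1 * M1 by rewrite mulr_gt0.
have S0 : 0 < S by rewrite /S !addr_gt0.
have kS1 : G * C1 <= S by rewrite /S; lra.
have kS2 : C1 * M1 <= S by rewrite /S; lra.
have kS3 : M2 <= S by rewrite /S; lra.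
clearbody S.
exists (C0 * S * (2 `^ (1 + alpha) * 2 `^ (2 * zeta))); first by rewrite !mulr_gt0 ?powR_gt0.
move=> sigma sigmaP t r s t0 r0 s0.
set T := t `^ alpha^-1.
have T0 : 0 < T by rewrite powR_gt0.
have Ta : T `^ alpha = t by rewrite /T -powRrM mulVf ?gt_eqF// powRr1// ltW.
set x : R := `|r - s|; have xx : (r - s) ^+ 2 = x ^+ 2 by rewrite /x real_normK// num_real.
have xrs : x <= r + s by rewrite /x ler_norml; apply/andP; split; lra.
have conclude (k X Y : R) : 0 <= k -> k <= S -> 0 < X -> 0 < Y -> T + x <= 2 * X -> T + r + s <= 2 * Y ->
    ((C0 * (k * (t / (X `^ (1 + alpha) * Y `^ (2 * zeta)))))%:E <=
    (C0 * S * (2 `^ (1 + alpha) * 2 `^ (2 * zeta)) * stable_profile zeta alpha t r s)%:E)%E.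
  move=> k0 kS X0 Y0 hX hY; rewrite lee_fin -!(mulrA C0) ler_pM2l// -(mulrA S).
  apply: ler_pM => //; first by rewrite divr_ge0 ?mulr_ge0 ?powR_ge0// ltW.
  exact: stable_profile_ge.
have rs0 : 0 < r + s by rewrite addr_gt0.
set Y := r + s in rs0 xrs *.
have Y0 : 0 < Y `^ (2 * zeta) by rewrite powR_gt0.
(* Off-diagonal regime, T <= |r-s| <= r + s: the Gaussian factor becomes 1 - e^(-u/x^2), of mean at
   most t x^(-alpha). *)
case: (leP T x) => Tx.
  have x0 : 0 < x by exact: lt_le_trans Tx.
  have X0 := powR_gt0 alpha x0.
  have hX : T + x <= 2 * x by lra.
  have hY : T + r + s <= 2 * Y by rewrite -addrA -/Y; lra.
  apply: le_trans (conclude _ _ _ (ltW k10) kS1 x0 rs0 hX hY).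
  pose K := C0 * (C1 / Y `^ (2 * zeta) * (G / x)).
  have K0 : 0 <= K.
    by rewrite ltW// mulr_gt0// mulr_gt0// divr_gt0.
  have i0 : 0 <= (x ^+ 2)^-1 by rewrite invr_ge0 sqr_ge0.
  apply: le_trans (palpha_le sigmaP z0 t0 r0 s0 K0 (measurable_onem_expRNM (x ^+ 2)^-1) _ _
    (stable_mean_onem_le sigmaP t0 i0)) _.
  - by move=> u u0; exact: onem_expRN_ge0.
  - move=> u u0; have /andP[_ h] := Hp u r s u0 r0 s0; apply: le_trans h _.
    rewrite /K -(mulrA C0) ler_pM2l//.
    apply: le_trans (HG u r s u0 r0 s0) _; rewrite -/Y -(mulrA (C1 / Y `^ (2 * zeta))).
    rewrite ler_wpM2l ?divr_ge0 ?(ltW C10) ?(ltW Y0)// xx.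
    exact: HE.
  rewrite lee_fin le_eqVlt; apply/orP; left; apply/eqP.
  rewrite powRV ?sqr_ge0// powR_sqr ?(ltW x0)// (_ : 2 * (alpha / 2) = alpha); last by field.
  rewrite powRDr// powRr1 ?(ltW x0)// /K; field.
  by rewrite !gt_eqF.
have TE : t / T `^ (1 + alpha) = T^-1.
  rewrite powRDr// powRr1 ?(ltW T0)// Ta; field; by rewrite !gt_eqF.
(* Near the diagonal the Gaussian factor is dropped. If T <= r + s, the weight (r+s)^(-2 zeta) is
   kept and the moment of order 1/2 gives 1/T = t / T^(1+alpha); otherwise the moment of order 1/2 +
   zeta supplies T^(-1 - 2 zeta). *)
case: (leP T Y) => TY.
  have hX : T + x <= 2 * T by lra.
  have hY : T + r + s <= 2 * Y by rewrite -addrA -/Y; lra.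
  apply: le_trans (conclude _ _ _ (ltW k20) kS2 T0 rs0 hX hY).
  pose K := C0 * (C1 / Y `^ (2 * zeta)).
  have K0 : 0 <= K by rewrite ltW// mulr_gt0// divr_gt0.
  have mp : measurable_fun setT (fun u : R => (u `^ 2^-1)^-1).
    have -> : (fun u : R => (u `^ 2^-1)^-1) = (fun u => u `^ (- 2^-1)).
      by apply/funext => u; rewrite powRN.
    exact: measurable_powR.
  apply: le_trans (palpha_le sigmaP z0 t0 r0 s0 K0 mp _ _ (HM1 _ sigmaP t t0)) _.
  - by move=> u u0; rewrite invr_ge0 powR_ge0.
  - move=> u u0; have /andP[_ h] := Hp u r s u0 r0 s0; apply: le_trans h _.
    rewrite /K -(mulrA C0) ler_pM2l//.
    apply: le_trans (HG u r s u0 r0 s0) _; rewrite -/Y.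
    rewrite ler_wpM2l ?divr_ge0 ?(ltW C10) ?(ltW Y0)// ler_piMl ?invr_ge0 ?powR_ge0//.
    by rewrite -expR0 ler_expR oppr_le0 divr_ge0 ?sqr_ge0// mulr_ge0 ?ler0n// ltW.
  rewrite lee_fin le_eqVlt; apply/orP; left; apply/eqP.
  rewrite -/T mulfV ?pnatr_eq0// powRr1 ?(ltW T0)//.
  rewrite (_ : t / _ = t / T `^ (1 + alpha) / Y `^ (2 * zeta)); last by rewrite invfM mulrA.
  rewrite TE /K; field.
  by rewrite !gt_eqF.
have hX : T + x <= 2 * T by lra.
have hY : T + r + s <= 2 * T by rewrite -addrA -/Y; lra.
apply: le_trans (conclude _ _ _ (ltW M20) kS3 T0 T0 hX hY).
have mp : measurable_fun setT (fun u : R => (u `^ (2^-1 + zeta))^-1).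
  have -> : (fun u : R => (u `^ (2^-1 + zeta))^-1) = (fun u => u `^ (- (2^-1 + zeta))).
    by apply/funext => u; rewrite powRN.
  exact: measurable_powR.
apply: le_trans (palpha_le sigmaP z0 t0 r0 s0 (ltW C00) mp _ _ (HM2 _ sigmaP t t0)) _.
- by move=> u u0; rewrite invr_ge0 powR_ge0.
- move=> u u0; have /andP[_ h] := Hp u r s u0 r0 s0; apply: le_trans h _.
  by rewrite ler_pM2l//; exact: heat_profile_le_power.
rewrite lee_fin ler_pM2l// -/T ler_pM2l// mulrDr mulfV ?pnatr_eq0// powRDr// powRr1 ?(ltW T0)//.
by rewrite !invfM mulrA TE.
Qed.

Lemma palpha_lower alpha zeta : 0 <= zeta -> 0 < alpha -> alpha < 2 ->
  exists2 c : R, 0 < c & forall sigma, is_stable_subordinator_density alpha sigma ->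
  forall t r s, 0 < t -> 0 < r -> 0 < s ->
  ((c * stable_profile zeta alpha t r s)%:E <= palpha sigma zeta t r s)%E.
Proof.
move=> z0 alpha0 alpha2.
have [c [C0 [c0 _ Hp]]] := p2_bounds z0.
have [a [b [a0 b0 Hm]]] := stable_annulus_mass alpha0 alpha2.
(* The infimum of the profile over the annulus, after scaling: u >= a y bounds the exponent, u <= b
   y bounds the denominator. *)
pose k : R := expR (- (4 * a)^-1) / ((2 * b) `^ 2^-1 * (2 * b + 1) `^ zeta).
have b20 : 0 < 2 * b by rewrite mulr_gt0.
have b210 : 0 < 2 * b + 1 by lra.
have k0 : 0 < k by rewrite divr_gt0 ?expR_gt0// mulr_gt0// powR_gt0.
exists (c * k / 4); first by rewrite divr_gt0// mulr_gt0.
move=> sigma sigmaP t r s t0 r0 s0; rewrite /stable_profile.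
set T := t `^ alpha^-1.
have T0 : 0 < T by rewrite powR_gt0.
have Ta : T `^ alpha = t by rewrite /T -powRrM mulVf ?gt_eqF// powRr1// ltW.
set x : R := `|r - s|; have xx : (r - s) ^+ 2 = x ^+ 2 by rewrite /x real_normK// num_real.
have x0 : 0 <= x by exact: normr_ge0.
have xrs : x <= r + s by rewrite /x ler_norml; apply/andP; split; lra.
have X0 : 0 < T + x by lra.
have Y0 : 0 < T + r + s by lra.
(* Only times u of order (T + |r-s|)^2 are kept. Their mass is of order t / (T + |r-s|)^alpha, at
   most 1 since T^alpha = t, and the kernel there contributes the remaining factor 1 / (T +
   |r-s|). *)
pose y := (T + x) ^+ 2.
have y0 : 0 < y by rewrite exprn_gt0.
have sE : t * (y^-1) `^ (alpha / 2) = t / (T + x) `^ alpha.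
  rewrite powRV ?sqr_ge0// powR_sqr ?(ltW X0)// (_ : 2 * (alpha / 2) = alpha)//; by field.
have Xa0 := powR_gt0 alpha X0.
have s1 : t * (y^-1) `^ (alpha / 2) <= 1.
  by rewrite sE ler_pdivrMr// mul1r -{1}Ta; apply: powR_homo; rewrite ?(ltW alpha0) ?(ltW T0)//; lra.
have := Hm _ sigmaP t y t0 y0 s1; rewrite sE => Hv.
have YZ0 := powR_gt0 (2 * zeta) Y0.
pose K := c * (k / ((T + x) * (T + r + s) `^ (2 * zeta))).
have K0 : 0 <= K by rewrite ltW// mulr_gt0// divr_gt0// mulr_gt0.
apply: le_trans _ (palpha_ge sigmaP z0 t0 r0 s0 K0 _ _ Hv).
- rewrite lee_fin /K powRDr// powRr1 ?(ltW X0)// le_eqVlt; apply/orP; left; apply/eqP.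
  by field; rewrite !gt_eqF.
- exact: measurable_itv.
move=> u u0; rewrite /= in_itv/= => /andP[uay uby].
have /andP[h _] := Hp u r s u0 r0 s0; apply: le_trans h.
rewrite /K ler_pM2l// /heat_profile /k xx.
have rs0 : 0 < r * s by rewrite mulr_gt0.
have e1 : expR (- (4 * a)^-1) <= expR (- (x ^+ 2 / (4 * u))).
  rewrite ler_expR lerN2 ler_pdivrMr ?mulr_gt0//.
  rewrite [leRHS](_ : _ = u / a); last by field; rewrite gt_eqF.
  rewrite ler_pdivlMr// mulrC; apply: le_trans uay; rewrite ler_pM2l//.
  by rewrite /y lerXn2r ?nnegrE ?(ltW X0)//; lra.
have e2 : (2 * u) `^ 2^-1 <= (2 * b) `^ 2^-1 * (T + x).
  have -> : T + x = y `^ 2^-1 by rewrite /y powR_sqr ?(ltW X0)// mulfV ?pnatr_eq0// powRr1// ltW.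
  rewrite -powRM ?(ltW b20) ?(ltW y0)//; apply: powR_homo; rewrite ?invr_ge0 ?mulr_ge0 ?(ltW u0)//.
  by rewrite -mulrA ler_pM2l.
have e3 : (2 * u + r * s) `^ zeta <= (2 * b + 1) `^ zeta * (T + r + s) `^ (2 * zeta).
  rewrite -(powR_sqr _ (ltW Y0)) -powRM ?(ltW b210) ?sqr_ge0//; apply: powR_homo => //.
    by rewrite addr_ge0 ?mulr_ge0// ltW.
  have yY : y <= (T + r + s) ^+ 2 by rewrite /y lerXn2r ?nnegrE ?(ltW X0) ?(ltW Y0)//; lra.
  have h1 : 2 * u <= 2 * b * (T + r + s) ^+ 2.
    by rewrite -mulrA ler_pM2l//; apply: le_trans uby _; rewrite ler_pM2l.
  have h2 : r * s <= (T + r + s) ^+ 2.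
    by rewrite expr2; apply: ler_pM; rewrite ?(ltW r0) ?(ltW s0)//; lra.
  by rewrite [leRHS]mulrDl mul1r; apply: lerD.
have p1 : 0 < (2 * u) `^ 2^-1 by rewrite powR_gt0// mulr_gt0.
have p2 : 0 < (2 * u + r * s) `^ zeta by rewrite powR_gt0// addr_gt0// mulr_gt0.
have p3 := powR_gt0 2^-1 b20; have p4 := powR_gt0 zeta b210.
rewrite -mulrA -invfM; apply: ler_pM => //; rewrite ?expR_ge0 ?invr_ge0 ?mulr_ge0 ?(ltW p3) ?(ltW p4) ?(ltW X0) ?(ltW YZ0)//.
rewrite lef_pV2 ?posrE ?mulr_gt0//.
rewrite [leRHS](_ : _ = ((2 * b) `^ 2^-1 * (T + x)) * ((2 * b + 1) `^ zeta * (T + r + s) `^ (2 * zeta))); last by ring.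
by apply: ler_pM => //; exact: ltW.
Qed.

End StableKernel.

(** * Transfer of the profile inequality to the kernel, and the product inequality *)

Theorem theorem3p1 (R : realType) (zeta alpha : R)
  (hzeta : 0 <= zeta) (halpha0 : 0 < alpha) (halpha2 : alpha < 2) :
  exists C : R, 0 < C /\
  forall sigma : R -> R -> R, is_stable_subordinator_density alpha sigma ->
  forall r s z t tau : R, 0 < r -> 0 < s -> 0 < z -> 0 < t -> 0 < tau ->
  ((Order.min
      ((((r + z) / (r + s + z)) `^ (2 * zeta))%:E * palpha sigma zeta t r z)
      ((((s + z) / (r + s + z)) `^ (2 * zeta))%:E * palpha sigma zeta tau z s)
    <= C%:E * palpha sigma zeta (t + tau) r s)%E
  /\
  (palpha sigma zeta t r z * palpha sigma zeta tau z s
    <= C%:E * palpha sigma zeta (t + tau) r s *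
       ((((r + s + z) / (s + z)) `^ (2 * zeta))%:E * palpha sigma zeta t r z
        + (((r + s + z) / (r + z)) `^ (2 * zeta))%:E * palpha sigma zeta tau z s)%E)%E).
Proof.
have [C1 C10 upper] := palpha_upper hzeta halpha0.
have [c c0 lower] := palpha_lower hzeta halpha0 halpha2.
have [C3 C30 threeG] := stable_profile_3G hzeta halpha0.
have K0 : 0 < C1 * C3 / c by rewrite divr_gt0// mulr_gt0.
exists (C1 * C3 / c); split => // sigma sigmaP r s z t tau r0 s0 z0 t0 tau0.
(* The two-sided bound makes every kernel value finite, so the remaining argument takes place in
   [R]. *)
have real_palpha t' r' s' : 0 < t' -> 0 < r' -> 0 < s' -> exists p : R,
    [/\ palpha sigma zeta t' r' s' = p%:E, 0 <= p,
        c * stable_profile zeta alpha t' r' s' <= p &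
        p <= C1 * stable_profile zeta alpha t' r' s'].
  move=> t'0 r'0 s'0.
  have := lower _ sigmaP _ _ _ t'0 r'0 s'0; have := upper _ sigmaP _ _ _ t'0 r'0 s'0.
  case: palpha => [p| |]//; rewrite !lee_fin => hu hl.
  exists p; split => //; apply: le_trans hl; rewrite mulr_ge0 ?(ltW c0)//.
  by rewrite ltW// stable_profile_gt0.
have [p1 [-> p10 _ up1]] := real_palpha _ _ _ t0 r0 z0.
have [p2 [-> p20 _ up2]] := real_palpha _ _ _ tau0 z0 s0.
have [p3 [-> p30 lo3 _]] := real_palpha _ _ _ (addr_gt0 t0 tau0) r0 s0.
have S0 : 0 < r + s + z by rewrite !addr_gt0.
have rz0 : 0 < r + z by rewrite addr_gt0.
have sz0 : 0 < s + z by rewrite addr_gt0.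
have transfer (w p f : R) : 0 <= w -> p <= C1 * f ->
    w * f <= C3 * stable_profile zeta alpha (t + tau) r s -> w * p <= C1 * C3 / c * p3.
  move=> w0 pf wf; apply: le_trans (ler_wpM2l w0 pf) _; rewrite mulrCA -!mulrA ler_pM2l//.
  apply: le_trans wf _; rewrite ler_pM2l//.
  by rewrite -(ler_pM2l c0) mulVKf ?gt_eqF.
have G : ((r + z) / (r + s + z)) `^ (2 * zeta) * p1 <= C1 * C3 / c * p3 \/
         ((s + z) / (r + s + z)) `^ (2 * zeta) * p2 <= C1 * C3 / c * p3.
  by case: (threeG r s z t tau r0 s0 z0 t0 tau0) => h; [left|right];
    exact: transfer (powR_ge0 _ _) _ h.
rewrite -!EFinM -EFin_min !lee_fin; split.
  by rewrite ge_min; case: G => ->; rewrite ?orbT.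
rewrite -(invf_div (s + z)) -(invf_div (r + z)) !powRV ?divr_ge0 ?(ltW S0) ?(ltW rz0) ?(ltW sz0)//.
move: G; set K := C1 * C3 / c.
have : 0 < ((s + z) / (r + s + z)) `^ (2 * zeta) by rewrite powR_gt0// divr_gt0.
have : 0 < ((r + z) / (r + s + z)) `^ (2 * zeta) by rewrite powR_gt0// divr_gt0.
set a := (_ / _) `^ _; set b := (_ / _) `^ _ => a0 b0 G.
have Kp0 : 0 <= K * p3 by rewrite mulr_ge0// ltW.
have q1 : 0 <= b^-1 * p1 by rewrite mulr_ge0// invr_ge0 ltW.
have q2 : 0 <= a^-1 * p2 by rewrite mulr_ge0// invr_ge0 ltW.
(* The weights [a] and [b] cancel in p1 p2 = (a p1)(a^-1 p2) = (b p2)(b^-1 p1). The weighted factor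
   that is bounded by K p3 is replaced, and the other one is a summand of the bracket. *)
case: G => h.
  apply: (@le_trans _ _ (K * p3 * (a^-1 * p2))); last by rewrite ler_wpM2l// lerDr.
  by rewrite [leLHS](_ : _ = a * p1 * (a^-1 * p2)) ?ler_wpM2r//; field; rewrite gt_eqF.
apply: (@le_trans _ _ (K * p3 * (b^-1 * p1))); last by rewrite ler_wpM2l// lerDl.
by rewrite [leLHS](_ : _ = b * p2 * (b^-1 * p1)) ?ler_wpM2r//; field; rewrite gt_eqF.
Qed.
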